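(* Let $R$ be a Noetherian ring. For every ideal $J \subseteq R$, $\dim R/(0:J^\infty)$ is the supremum of the length of weighted independent sequences in $J$ with respect to an arbitrary weight sequence $\mathbf{w}$.
   Context: All rings are commutative with identity; $\dim$ denotes Krull dimension. $0:J^\infty := \bigcup_{m \ge 0} (0:J^m)$, where $0:J^m = \{r \in R \mid rJ^m = 0\}$. A weight sequence is an infinite sequence $\mathbf{w} = w_1,w_2,\ldots$ of positive integers; it makes $R[x_1,x_2,\ldots]$ a weighted graded ring with $\deg x_i = w_i$. For a polynomial $f$, $\operatorname{in}_{\mathbf{w}}(f)$ denotes the weighted homogeneous part of $f$ of least degree. A sequence $a_1,\ldots,a_s$ of elements of $R$ is called weighted independent with respect to $\mathbf{w}$ if, for all polynomials $f \in R[x_1,\ldots,x_s]$ vanishing at $a_1,\ldots,a_s$, every coefficient of $\operatorname{in}_{\mathbf{w}}(f)$ is not invertible in $R$. A sequence in $J$ is a sequence of elements of $J$. *)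

(* Defs.v *)
From HB Require Import structures.
From mathcomp Require Import all_boot all_order all_algebra.
From mathcomp Require Import boolp classical_sets.
From mathcomp Require Import finmap monalg.

Set Implicit Arguments.
Unset Strict Implicit.
Unset Printing Implicit Defensive.

Import GRing.Theory.

Local Open Scope classical_set_scope.
Local Open Scope ring_scope.
Local Open Scope quotient_scope.

(* The zero ring is allowed throughout ([comPzRingType], not [comNzRingType]):
   R / (0 : J^oo) is the zero ring as soon as J is nilpotent.  The ideals and
   quotient rings of [ring_quotient] only cover nonzero quotients. *)

Section Ideals.
Context {R : comPzRingType}.

Definition is_ideal (I : set R) : Prop :=
  [/\ I 0, forall x y, I x -> I y -> I (x + y) & forall a x, I x -> I (a * x)].

Record ideal := Ideal { ideal_set :> set R ; idealP : is_ideal ideal_set }.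

Lemma ideal0 (I : ideal) : ideal_set I 0. Proof. by case: (idealP I). Qed.

Lemma idealD (I : ideal) x y : ideal_set I x -> ideal_set I y -> ideal_set I (x + y).
Proof. by case: (idealP I) => _ + _; apply. Qed.

Lemma idealM (I : ideal) a x : ideal_set I x -> ideal_set I (a * x).
Proof. by case: (idealP I) => _ _; apply. Qed.

Lemma idealN (I : ideal) x : ideal_set I x -> ideal_set I (- x).
Proof. by move=> Ix; rewrite -mulN1r; exact: idealM. Qed.

Definition ideal_gen (S : set R) : set R :=
  [set x | forall I : ideal, S `<=` I -> ideal_set I x].

Lemma ideal_gen_subproof S : is_ideal (ideal_gen S).
Proof.
split=> [I _|x y Sx Sy I SI|a x Sx I SI]; first exact: ideal0.
  by apply: idealD; [exact: Sx | exact: Sy].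
by apply: idealM; exact: Sx.
Qed.

Definition gen_ideal (S : set R) : ideal := Ideal (ideal_gen_subproof S).

Definition ideal_mul (I K : set R) : ideal :=
  gen_ideal [set z | exists x y, [/\ I x, K y & z = x * y]].

Fixpoint ideal_pow (J : set R) (m : nat) : ideal :=
  if m is m'.+1 then ideal_mul J (ideal_pow J m') else gen_ideal setT.

Definition annihilator (S : set R) : set R :=
  [set r | forall x, S x -> r * x = 0].

Definition colon_zero_infty (J : set R) : set R :=
  \bigcup_(m in [set: nat]) annihilator (ideal_pow J m).

Lemma ideal_powS (J : set R) m : ideal_pow J m.+1 `<=` ideal_pow J m.
Proof.
by move=> x; apply=> _ [a [b [_ Jb ->]]]; exact: idealM.
Qed.

Lemma ideal_pow_le (J : set R) m n :
  (m <= n)%N -> ideal_pow J n `<=` ideal_pow J m.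
Proof.
move=> /subnKC <-; elim: (n - m)%N => [|k IHk]; first by rewrite addn0.
by rewrite addnS; apply: subset_trans IHk; exact: ideal_powS.
Qed.

Lemma colon_zero_infty_subproof (J : set R) : is_ideal (colon_zero_infty J).
Proof.
split=> [|x y [m _ mx] [n _ ny]|a x [m _ mx]].
- by exists 0%N => // x _; rewrite mul0r.
- exists (maxn m n) => // z Jz; rewrite mulrDl mx ?ny ?addr0 //.
    by move: z Jz; apply: ideal_pow_le; exact: leq_maxr.
  by move: z Jz; apply: ideal_pow_le; exact: leq_maxl.
- by exists m => // z Jz; rewrite -mulrA mx ?mulr0.
Qed.

Definition colon_zero_infty_ideal (J : set R) : ideal :=
  Ideal (colon_zero_infty_subproof J).

Definition prime_ideal (P : set R) : Prop :=
  [/\ is_ideal P, ~ P 1 & forall x y, P (x * y) -> P x \/ P y].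

End Ideals.

Arguments ideal R : clear implicits.

Definition noetherian (R : comPzRingType) : Prop :=
  forall I : ideal R, exists s : seq R, (I : set R) = ideal_gen [set` s].

Section QuotientRing.
Context {R : comPzRingType} (I : ideal R).

Definition ideal_pred : pred R := fun x => `[< ideal_set I x >].

Lemma ideal_pred_zmod_closed : zmod_closed ideal_pred.
Proof.
split=> [|x y /asboolP Ix /asboolP Iy]; apply/asboolP; first exact: ideal0.
by apply: idealD => //; exact: idealN.
Qed.

HB.instance Definition _ := GRing.isZmodClosed.Build R ideal_pred
  ideal_pred_zmod_closed.

Definition ideal_zmod : zmodClosed R := GRing.ZmodClosed.clone R ideal_pred _.

Definition quotient_ring : Type := Quotient.quot ideal_zmod.

HB.instance Definition _ := GRing.Zmodule.on quotient_ring.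
HB.instance Definition _ := EqQuotient.on quotient_ring.

Definition quotient_one : quotient_ring := \pi_quotient_ring 1.

Definition quotient_mul (x y : quotient_ring) : quotient_ring :=
  \pi_quotient_ring (repr x * repr y).

Lemma quotient_eqP (x y : R) :
  reflect (\pi_quotient_ring x = \pi_quotient_ring y) (`[< ideal_set I (x - y) >]).
Proof.
have := Quotient.idealrBE ideal_zmod x y.
by rewrite unfold_in => ->; exact: eqP.
Qed.

Lemma quotient_piM x y :
  quotient_mul (\pi x) (\pi y) = \pi_quotient_ring (x * y).
Proof.
have h z : ideal_set I (repr (\pi_quotient_ring z) - z).
  by apply/asboolP/quotient_eqP; rewrite reprK.
apply/quotient_eqP/asboolP.
set x' := repr _; set y' := repr _.
have -> : x' * y' - x * y = y' * (x' - x) + x * (y' - y).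
  by rewrite !mulrBr addrA [y' * x']mulrC [y' * x]mulrC subrK.
by apply: idealD; apply: idealM; exact: h.
Qed.

Lemma quotient_mulA : associative quotient_mul.
Proof.
by move=> x y z; rewrite -[x]reprK -[y]reprK -[z]reprK !quotient_piM mulrA.
Qed.

Lemma quotient_mulC : commutative quotient_mul.
Proof. by move=> x y; rewrite /quotient_mul mulrC. Qed.

Lemma quotient_mul1 : left_id quotient_one quotient_mul.
Proof. by move=> x; rewrite -[x]reprK quotient_piM mul1r. Qed.

Lemma quotient_piD x y :
  (\pi_quotient_ring x + \pi_quotient_ring y : quotient_ring) =
  \pi_quotient_ring (x + y).
Proof. by apply/esym; exact: (@Quotient.pi_add R ideal_zmod). Qed.

Lemma quotient_mulDl : left_distributive quotient_mul +%R.
Proof.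
move=> x y z; rewrite -[x]reprK -[y]reprK -[z]reprK.
by rewrite !(quotient_piM, quotient_piD) mulrDl.
Qed.

HB.instance Definition _ := GRing.Zmodule_isComPzRing.Build quotient_ring
  quotient_mulA quotient_mulC quotient_mul1 quotient_mulDl.

End QuotientRing.

(* Supremum in nat \cup {oo}, with [None] standing for oo; in particular the
   supremum of the empty set is 0. *)
Definition nat_sup (A : set nat) : option nat :=
  if `[< has_ubound A >] then Some (supremum 0%N A) else None.

Definition prime_chain (A : comPzRingType) (n : nat) : Prop :=
  exists P : nat -> set A,
    (forall i, (i <= n)%N -> prime_ideal (P i)) /\
    (forall i, (i < n)%N -> P i `<` P i.+1).

(* Since the supremum is taken in nat \cup {oo}, the zero ring gets dimension 0.
   No other value is compatible with a formula for dim R/(0 : J^oo) as a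
   supremum of lengths that holds for nilpotent J as well. *)
Definition krull_dim (A : comPzRingType) : option nat :=
  nat_sup [set n | prime_chain A n].

Definition invertible (R : comPzRingType) (c : R) : Prop :=
  exists d, c * d = 1.

Section WeightedIndependence.
Context {R : comPzRingType} {s : nat} (w : nat -> nat).

(* Here {mpoly R[s]} is {malg R['X_{1..s}]}, the finitely supported families of
   coefficients indexed by monomials, which makes sense over the zero ring. *)

Definition wdeg (m : 'X_{1..s}) : nat := (\sum_(i < s) w i * m i)%N.

Definition is_least_wdeg (f : {mpoly R[s]}) (d : nat) : bool :=
  (d \in [seq wdeg m | m <- msupp f]) &&
  all (fun m => d <= wdeg m)%N (msupp f).

Definition initial_form (f : {mpoly R[s]}) : {mpoly R[s]} :=
  \sum_(m <- msupp f | is_least_wdeg f (wdeg m)) << f@_m *g m >>.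

(* The formula of [mmap], which is only available over nonzero rings. *)
Definition peval (a : 'I_s -> R) (f : {mpoly R[s]}) : R :=
  \sum_(m <- msupp f) f@_m * \prod_(i < s) a i ^+ m i.

(* All coefficients are considered, including those which are 0; this matters
   only over the zero ring, where 0 is invertible. *)
Definition weighted_independent (a : 'I_s -> R) : Prop :=
  forall f : {mpoly R[s]}, peval a f = 0 ->
    forall m : 'X_{1..s}, ~ invertible (initial_form f)@_m.

End WeightedIndependence.

(* Main.v *)
(* Write K for 0 : J^oo.  Two estimates of lengths at a maximal ideal M are
   confronted with counts of monomials: if no chain of d + 2 primes lies between
   I and M, then R / (I + M^k) has length O(k^d), by noetherian induction on I;
   if there is a chain of n + 1 primes between I and M, then this length grows at
   least like k^n, by the Artin-Rees lemma.

   Let a_1, ..., a_n be independent elements of J.  The coefficients of initial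
   forms of the polynomials f with f(a) in K generate a proper ideal, contained in
   some maximal ideal M.  The Artin-Rees lemma for multiplication by t in the
   extended Rees algebra R[t, a_i t^(- w_i)] then gives c such that a polynomial
   of order d with an initial coefficient outside M takes its value at a outside
   K + M^(c d + 1).  Hence monomials in a give R / (K + M^k) a length of order at
   least k^n, and there is a chain of n + 1 primes above K.

   Conversely, a chain of n + 1 primes above K may be taken to start at a prime Q
   not containing J; choose c in J outside Q, a maximal ideal M above the chain,
   and generators b_1, ..., b_r of M.  If (b_i c)^(w_i), i in S, were dependent
   for all S of size n, each S would give a monomial in (b_i), i in S, that
   reduces modulo Q to smaller monomials of the same degree and to higher powers
   of M.  The monomials of degree at most k that none of these reductions applies
   to have fewer than n large exponents, so there are O(k^(n - 1)) of them, and
   R / (Q + M^(k + 1)) would be too short. *)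
From HB Require Import structures.
Require Import Defs.
From mathcomp Require Import all_boot all_order all_algebra.
From mathcomp Require Import boolp classical_sets.
From mathcomp Require Import ring zify.
From mathcomp Require Import finmap monalg.

Set Implicit Arguments.
Unset Strict Implicit.
Unset Printing Implicit Defensive.

Import GRing.Theory.

Local Open Scope classical_set_scope.
Local Open Scope ring_scope.

Local Notation "x \isin I" := (ideal_set I x) (at level 70, no associativity).

(** * Ideals *)

Section IdealOperations.
Context {R : comPzRingType}.
Implicit Types (I K L : ideal R) (x y r : R).

Lemma idealMr I x r : x \isin I -> x * r \isin I.
Proof. by rewrite mulrC; exact: idealM. Qed.

Lemma idealB I x y : x \isin I -> y \isin I -> x - y \isin I.
Proof. by move=> Ix Iy; apply: idealD => //; exact: idealN. Qed.

Lemma idealDl I x y : x \isin I -> x + y \isin I -> y \isin I.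
Proof. by move=> Ix Ixy; rewrite -[y](addKr x); apply: idealD => //; exact: idealN. Qed.

Lemma ideal_sum I (T : Type) (s : seq T) (P : pred T) (F : T -> R) :
  (forall i, P i -> F i \isin I) -> \sum_(i <- s | P i) F i \isin I.
Proof.
by move=> FI; elim/big_rec: _ => [|i x Pi Ix]; [exact: ideal0|apply: idealD; auto].
Qed.

Lemma ideal_sub1 I : 1 \isin I -> forall x, x \isin I.
Proof. by move=> I1 x; rewrite -[x]mulr1; exact: idealM. Qed.

Lemma ideal_sum_subproof I K :
  is_ideal [set z | exists x y, [/\ x \isin I, y \isin K & z = x + y]].
Proof.
split=> [|z t [x [y [Ix Ky ->]]] [x' [y' [Ix' Ky' ->]]]|a z [x [y [Ix Ky ->]]]].
- by exists 0, 0; rewrite addr0; split => //; exact: ideal0.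
- by exists (x + x'), (y + y'); split; [exact: idealD|exact: idealD|ring].
- by exists (a * x), (a * y); split; [exact: idealM|exact: idealM|ring].
Qed.

Definition ideal_add I K : ideal R := Ideal (ideal_sum_subproof I K).

Lemma ideal_adjoin_subproof I x :
  is_ideal [set z | exists r, z - r * x \isin I].
Proof.
split=> [|z t [r Ir] [s Is]|a z [r Ir]].
- by exists 0; rewrite mul0r subr0; exact: ideal0.
- exists (r + s).
  have -> : z + t - (r + s) * x = (z - r * x) + (t - s * x) by ring.
  exact: idealD.
- exists (a * r); have -> : a * z - a * r * x = a * (z - r * x) by ring.
  exact: idealM.
Qed.

Definition ideal_adjoin I x : ideal R := Ideal (ideal_adjoin_subproof I x).

Lemma colon_subproof I x : is_ideal [set z | z * x \isin I].
Proof.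
split=> [|z t /= Iz It|a z /= Iz].
- by rewrite /= mul0r; exact: ideal0.
- by rewrite mulrDl; exact: idealD.
- by rewrite -mulrA; exact: idealM.
Qed.

Definition colon I x : ideal R := Ideal (colon_subproof I x).

Lemma colonP I x z : z * x \isin I <-> z \isin colon I x.
Proof. by []. Qed.

Lemma ideal_addl I K : I `<=` ideal_add I K.
Proof. by move=> x Ix; exists x, 0; rewrite addr0; split=> //; exact: ideal0. Qed.

Lemma ideal_addr I K : K `<=` ideal_add I K.
Proof. by move=> x Ix; exists 0, x; rewrite add0r; split=> //; exact: ideal0. Qed.

Lemma ideal_add_sub I K L : I `<=` L -> K `<=` L -> ideal_add I K `<=` L.
Proof. by move=> IL KL _ [x [y [Ix Ky ->]]]; apply: idealD; auto. Qed.

Lemma ideal_adjoinl I x : I `<=` ideal_adjoin I x.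
Proof. by move=> y Iy; exists 0; rewrite mul0r subr0. Qed.

Lemma ideal_adjoinr I x : x \isin ideal_adjoin I x.
Proof. by exists 1; rewrite mul1r subrr; exact: ideal0. Qed.

Lemma ideal_adjoin_sub I x L : I `<=` L -> x \isin L -> ideal_adjoin I x `<=` L.
Proof.
by move=> IL Lx y [r /IL Lyr]; rewrite -(subrK (r * x) y); apply/idealD/idealM.
Qed.

Lemma gen_ideal_sub (S : set R) L : S `<=` L -> gen_ideal S `<=` L.
Proof. by move=> SL x; apply. Qed.

Lemma gen_ideal_mem (S : set R) : S `<=` gen_ideal S.
Proof. by move=> x Sx I; apply. Qed.

Lemma ideal_pow0 (J : set R) x : x \isin ideal_pow J 0.
Proof. exact: gen_ideal_mem. Qed.

Lemma ideal_powM (J : set R) m x y :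
  J x -> y \isin ideal_pow J m -> x * y \isin ideal_pow J m.+1.
Proof. by move=> Jx Jy; apply: gen_ideal_mem; exists x, y. Qed.

Lemma ideal_pow_ind (J : set R) m (L : ideal R) :
  (forall x y, J x -> y \isin ideal_pow J m -> x * y \isin L) ->
  ideal_pow J m.+1 `<=` L.
Proof. by move=> JL; apply: gen_ideal_sub => _ [x [y [Jx Jy ->]]]; exact: JL. Qed.

Lemma ideal_pow1 (J : set R) x : J x -> x \isin ideal_pow J 1.
Proof. by move=> Jx; rewrite -[x]mulr1; apply: ideal_powM => //; exact: ideal_pow0. Qed.

Lemma ideal_pow_sub (J : ideal R) m : ideal_pow J m.+1 `<=` J.
Proof. by apply: ideal_pow_ind => x y Jx _; exact: idealMr. Qed.

Lemma ideal_powD (J : set R) m n x y :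
  x \isin ideal_pow J m -> y \isin ideal_pow J n -> x * y \isin ideal_pow J (m + n).
Proof.
elim: m x => [|m IHm] x Jx Jy; first exact: idealM.
have : ideal_pow J m.+1 `<=` colon (ideal_pow J (m.+1 + n)) y.
  apply: ideal_pow_ind => u v Ju Jv /=; rewrite -mulrA.
  by apply: (@ideal_powM J (m + n)) => //; exact: IHm.
exact.
Qed.

Lemma ideal_pow_exp (J : set R) x m : J x -> x ^+ m \isin ideal_pow J m.
Proof.
move=> Jx; elim: m => [|m IHm]; first exact: ideal_pow0.
by rewrite exprS; exact: ideal_powM.
Qed.

Lemma ideal_pow_split (J : set R) m n (L : ideal R) :
  (forall x y, x \isin ideal_pow J m -> y \isin ideal_pow J n -> x * y \isin L) ->
  ideal_pow J (m + n) `<=` L.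
Proof.
elim: m L => [|m IHm] L JL.
  by move=> y Jy; rewrite -[y]mul1r; apply: JL => //; exact: ideal_pow0.
apply: ideal_pow_ind => x y Jx Jy; rewrite mulrC.
move: y Jy; apply: (IHm (colon L x)) => u v Ju Jv /=.
by rewrite mulrC mulrA; apply: JL => //; exact: ideal_powM.
Qed.

Lemma prime_is_ideal (P : set R) :
  prime_ideal P -> exists I : ideal R, ideal_set I = P.
Proof. by case=> iP _ _; exists (Ideal iP). Qed.

Lemma prime_expr (P : set R) x n : prime_ideal P -> P (x ^+ n) -> P x.
Proof.
move=> [iP P1 PM]; elim: n => [|n IHn]; first by rewrite expr0.
by rewrite exprS => /PM[].
Qed.

End IdealOperations.

(** Encoded as invertibility modulo [M] of every element outside [M], the form in which maximality
    is applied. *)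
Definition maximal_ideal (R : comPzRingType) (M : ideal R) : Prop :=
  ~ 1 \isin M /\ forall x, ~ x \isin M -> exists y, y * x - 1 \isin M.

(** * Noetherian induction and maximal ideals *)

Section Noetherian.
Context {R : comPzRingType}.
Hypothesis noethR : noetherian R.
Implicit Types (I K L : ideal R).

Lemma noetherian_fg I : exists s : seq R, (forall x, x \in s -> x \isin I) /\
  forall L, (forall x, x \in s -> x \isin L) -> I `<=` L.
Proof.
have [s Is] := noethR I; exists s; rewrite Is.
by split=> [x sx K|L sL x]; apply.
Qed.

(** A failure of [Q] would propagate to strictly larger ideals; choice then gives a strictly
    increasing sequence of ideals, while the finitely many generators of its union already lie in
    one term. *)
Lemma noetherian_ind (Q : ideal R -> Prop) :
  (forall I, (forall K, I `<=` K -> ~ (K `<=` I) -> Q K) -> Q I) -> forall I, Q I.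
Proof.
move=> QI I; apply: contrapT => nQI.
have step K : ~ Q K -> exists L, [/\ K `<=` L, ~ (L `<=` K) & ~ Q L].
  move=> nQK; apply: contrapT => nL; apply: nQK; apply: QI => L KL nLK.
  by apply: contrapT => nQL; apply: nL; exists L.
pose T := {K | ~ Q K}.
have /choice[next nextP] (K : T) :
    exists L : T, sval K `<=` sval L /\ ~ (sval L `<=` sval K).
  by case: K => K nQK; have [L [? ? nQL]] := step K nQK; exists (exist _ L nQL).
pose F n := sval (iter n next (exist _ I nQI)).
have FS n : F n `<=` F n.+1 /\ ~ (F n.+1 `<=` F n) by exact: nextP.
have Fle m n : (m <= n)%N -> F m `<=` F n.
  elim: n => [|n IHn]; first by rewrite leqn0 => /eqP ->.
  rewrite leq_eqVlt => /orP[/eqP -> //|/IHn mn].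
  by apply: subset_trans (FS n).1.
have iU : is_ideal (\bigcup_n F n).
  split=> [|x y [m _ mx] [n _ ny]|a x [m _ mx]].
  - by exists 0%N => //; exact: ideal0.
  - exists (maxn m n) => //; apply: idealD.
      by move: mx; apply: Fle; exact: leq_maxl.
    by move: ny; apply: Fle; exact: leq_maxr.
  - by exists m => //; exact: idealM.
have [s [sU genU]] := noetherian_fg (Ideal iU).
have [n sn] : exists n, forall x, x \in s -> x \isin F n.
  elim: s sU {genU} => [|x s IHs] sU; first by exists 0%N.
  have [|n sn] := IHs; first by move=> y ys; apply: sU; rewrite inE ys orbT.
  have [m _ mx] := sU x (mem_head _ _).
  exists (maxn m n) => y; rewrite inE => /orP[/eqP ->|/sn].
    by move: mx; apply: Fle; exact: leq_maxl.
  by apply: Fle; exact: leq_maxr.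
by apply: (FS n).2 => x Fx; apply: (genU (F n) sn); exists n.+1.
Qed.

Lemma noetherian_max (Q : ideal R -> Prop) I : Q I ->
  exists M : ideal R, [/\ I `<=` M, Q M & forall K, M `<=` K -> ~ (K `<=` M) -> ~ Q K].
Proof.
elim/noetherian_ind: I => I IH QI.
have [[K [IK nKI QK]]|nK] := pselect (exists K, [/\ I `<=` K, ~ (K `<=` I) & Q K]).
  have [M [KM QM maxM]] := IH K IK nKI QK.
  by exists M; split=> //; apply: subset_trans KM.
by exists I; split=> // K IK nKI QK; apply: nK; exists K.
Qed.

Lemma maximal_ideal_exists I : ~ 1 \isin I -> exists2 M : ideal R, I `<=` M & maximal_ideal M.
Proof.
move=> /(noetherian_max (Q := fun K => ~ 1 \isin K))[M [IM M1 maxM]].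
exists M => //; split=> // x nMx.
have := maxM (ideal_adjoin M x) (@ideal_adjoinl _ _ _).
move=> /(_ (fun s => nMx (s _ (ideal_adjoinr _ _)))) /contrapT[r /idealN].
by rewrite opprB; exists r.
Qed.

End Noetherian.

Lemma maximal_prime (R : comPzRingType) (M : ideal R) :
  maximal_ideal M -> prime_ideal M.
Proof.
case=> M1 maxM; split=> // [|x y Mxy]; first exact: idealP.
have [|/maxM[z Mz]] := pselect (x \isin M); [by left|right].
have -> : y = z * (x * y) - (z * x - 1) * y by ring.
by apply: idealB; [exact: idealM|exact: idealMr].
Qed.

(** * Hilbert's basis theorem for subrings *)

Section HilbertBasis.
Context {E : comPzRingType}.
Implicit Types (T H : set E) (s : seq E).

(** Subrings are subsets of a fixed ring [E], so that adjoining elements one after another stays in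
    one type. *)
Definition is_subring T : Prop :=
  [/\ T 1, forall x y, T x -> T y -> T (x - y) & forall x y, T x -> T y -> T (x * y)].

Definition is_submodule T H : Prop :=
  [/\ H 0, forall x y, H x -> H y -> H (x + y) & forall t x, T t -> H x -> H (t * x)].

Fixpoint lin_comb T s (x : E) : Prop :=
  if s is y :: s' then exists t z, [/\ T t, lin_comb T s' z & x = t * y + z] else x = 0.

Definition noetherian_subring T : Prop :=
  is_subring T /\ forall H, H `<=` T -> is_submodule T H ->
    exists s, (forall x, x \in s -> H x) /\ H `<=` lin_comb T s.

Lemma subring0 T : is_subring T -> T 0.
Proof. by case=> T1 TB _; rewrite -(subrr 1); exact: TB. Qed.

Lemma subringB T x y : is_subring T -> T x -> T y -> T (x - y).
Proof. by case=> _ TB _; exact: TB. Qed.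

Lemma subringM T x y : is_subring T -> T x -> T y -> T (x * y).
Proof. by case=> _ _ TM; exact: TM. Qed.

Lemma subringN T x : is_subring T -> T x -> T (- x).
Proof. by move=> sT Tx; rewrite -sub0r; apply: subringB => //; exact: subring0. Qed.

Lemma subringD T x y : is_subring T -> T x -> T y -> T (x + y).
Proof.
by move=> sT Tx Ty; rewrite -[y]opprK; apply: subringB => //; exact: subringN.
Qed.

Lemma subringX T x n : is_subring T -> T x -> T (x ^+ n).
Proof.
move=> sT Tx; elim: n => [|n IHn]; first by case: sT.
by rewrite exprS; exact: subringM.
Qed.

Lemma lin_comb_sub T H s : is_submodule T H -> (forall x, x \in s -> H x) ->
  lin_comb T s `<=` H.
Proof.
case=> H0 HD HM; elim: s => [_ _ -> //|y s IHs] sH _ [t [z [Tt Tz ->]]].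
apply: HD; first by apply: HM => //; apply: sH; exact: mem_head.
by apply: IHs => // x xs; apply: sH; rewrite inE xs orbT.
Qed.

Lemma lin_comb_submodule T s : is_subring T -> is_submodule T (lin_comb T s).
Proof.
move=> sT; have T0 := subring0 sT.
elim: s => [|y s [IH0 IHD IHM]].
  by split=> [//|x y -> ->|t x Tt ->] /=; rewrite ?addr0 ?mulr0.
split=> [|_ _ [t [z [Tt Tz ->]]] [u [v [Tu Tv ->]]]|a _ Ta [t [z [Tt Tz ->]]]].
- by exists 0, 0; split=> //; rewrite mul0r addr0.
- exists (t + u), (z + v); split; [exact: subringD|exact: IHD|by ring].
- exists (a * t), (a * z); split; last by ring.
    exact: subringM.
  exact: IHM.
Qed.

Lemma lin_comb_mem T s x : is_subring T -> x \in s -> lin_comb T s x.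
Proof.
move=> sT; elim: s => // y s IHs; rewrite inE => /orP[/eqP ->|xs].
  exists 1, 0; split; [by case: sT| |by ring].
  by case: (lin_comb_submodule s sT).
by exists 0, x; split; [exact: subring0|exact: IHs|ring].
Qed.

Section Adjoin.
Variables (T : set E) (e : E).
Hypothesis sT : is_subring T.

(** Expressions in [e] of formal degree less than [n]. As [e] may satisfy equations over [T], the
    degree belongs to the expression and not to its value. *)
Fixpoint adjoin_lt (n : nat) : set E :=
  if n is n'.+1 then [set x | exists y t, [/\ adjoin_lt n' y, T t & x = y + t * e ^+ n']]
  else [set 0].

Definition adjoin : set E := \bigcup_n adjoin_lt n.

Lemma adjoin_lt_le m n : (m <= n)%N -> adjoin_lt m `<=` adjoin_lt n.
Proof.
move=> /subnK <-; elim: (n - m)%N => [//|k IHk] x mx.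
by exists x, 0; split; [exact: IHk|exact: subring0|ring].
Qed.

Lemma adjoin_lt0 n : adjoin_lt n 0.
Proof. exact: (@adjoin_lt_le 0). Qed.

Lemma adjoin_ltB n x y : adjoin_lt n x -> adjoin_lt n y -> adjoin_lt n (x - y).
Proof.
elim: n x y => [|n IHn] x y /=; first by move=> -> ->; rewrite subr0.
move=> [u [t [nu Tt ->]]] [v [t' [nv Tt' ->]]].
exists (u - v), (t - t'); split; [exact: IHn|exact: subringB|ring].
Qed.

Lemma adjoin_ltD n x y : adjoin_lt n x -> adjoin_lt n y -> adjoin_lt n (x + y).
Proof.
move=> nx ny; rewrite -[y]opprK; apply: adjoin_ltB => //.
by rewrite -sub0r; apply: adjoin_ltB => //; exact: adjoin_lt0.
Qed.

Lemma adjoin_ltZ n t x : T t -> adjoin_lt n x -> adjoin_lt n (t * x).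
Proof.
move=> Tt; elim: n x => [|n IHn] x /=; first by move=> ->; rewrite mulr0.
move=> [u [t' [nu Tt' ->]]].
exists (t * u), (t * t'); split; [exact: IHn|exact: subringM|ring].
Qed.

Lemma adjoin_ltX n k x : adjoin_lt n x -> adjoin_lt (n + k) (e ^+ k * x).
Proof.
elim: k => [|k IHk] nx; first by rewrite addn0 mul1r.
rewrite exprS -mulrA addnS; have := IHk nx.
elim: (n + k)%N (e ^+ k * x) => [|j IHj] y.
  by move=> ->; rewrite mulr0; exact: adjoin_lt0.
by move=> [u [t [nu Tt ->]]]; exists (e * u), t; split; [exact: IHj| |rewrite exprS; ring].
Qed.

Lemma adjoin_ltM m n x y : adjoin_lt m x -> adjoin_lt n y -> adjoin_lt (m + n) (x * y).
Proof.
move=> mx; elim: n y => [|n IHn] y; first by move=> ->; rewrite mulr0; exact: adjoin_lt0.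
move=> [u [t [nu Tt ->]]]; rewrite mulrDr; apply: adjoin_ltD.
  by apply: adjoin_lt_le (IHn _ nu); rewrite leq_add2l.
have -> : x * (t * e ^+ n) = e ^+ n * (t * x) by ring.
apply: (@adjoin_lt_le (m + n)); first by rewrite leq_add2l.
by apply: adjoin_ltX; exact: adjoin_ltZ.
Qed.

Lemma sub_adjoin : T `<=` adjoin.
Proof.
by move=> t Tt; exists 1%N => //=; exists 0, t; split=> //; rewrite expr0; ring.
Qed.

Lemma adjoin_gen : adjoin e.
Proof.
exists 2 => //; exists 0, 1; split; [exact: adjoin_lt0|by case: sT|rewrite expr1; ring].
Qed.

Lemma adjoin_subring : is_subring adjoin.
Proof.
split=> [|x y [m _ mx] [n _ ny]|x y [m _ mx] [n _ ny]].
- by apply: sub_adjoin; case: sT.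
- exists (maxn m n) => //; apply: adjoin_ltB.
    by move: mx; apply: adjoin_lt_le; exact: leq_maxl.
  by move: ny; apply: adjoin_lt_le; exact: leq_maxr.
- by exists (m + n)%N => //; exact: adjoin_ltM.
Qed.

Lemma adjoin_min A : is_subring A -> T `<=` A -> A e -> adjoin `<=` A.
Proof.
move=> sA TA Ae x [n _]; elim: n x => [|n IHn] x; first by move=> ->; exact: subring0.
move=> [y [t [ny Tt ->]]]; apply: subringD => //; first exact: IHn.
by apply: subringM => //; [exact: TA|exact: subringX].
Qed.

Lemma hilbert_basis : noetherian_subring T -> noetherian_subring adjoin.
Proof.
move=> [_ noethT]; split; first exact: adjoin_subring.
have sA := adjoin_subring.
move=> H HA modH; have [H0 HD HM] := modH.
have eA n : adjoin (e ^+ n) by apply: subringX => //; exact: adjoin_gen.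
(* The leading coefficients of the elements of [H] of formal degree [n] in [e]
   form ideals of [T] that increase with [n], hence are eventually constant. *)
pose L n := [set t | T t /\ exists2 y, adjoin_lt n y & H (y + t * e ^+ n)].
have Lmod n : is_submodule T (L n).
  split=> [|t u [Tt [y ny Hy]] [Tu [z nz Hz]]|a t Ta [Tt [y ny Hy]]].
  - split; first exact: subring0.
    by exists 0; [exact: adjoin_lt0|rewrite mul0r addr0].
  - split; first exact: subringD.
    exists (y + z); first exact: adjoin_ltD.
    have -> : y + z + (t + u) * e ^+ n = (y + t * e ^+ n) + (z + u * e ^+ n) by ring.
    exact: HD.
  - split; first exact: subringM.
    exists (a * y); first exact: adjoin_ltZ.
    have -> : a * y + a * t * e ^+ n = a * (y + t * e ^+ n) by ring.
    by apply: HM => //; exact: sub_adjoin.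
have Lle m n : (m <= n)%N -> L m `<=` L n.
  move=> mn t [Tt [y my Hy]]; split=> //; exists (e ^+ (n - m) * y).
    by rewrite -{1}(subnKC mn); exact: adjoin_ltX.
  have -> : e ^+ (n - m) * y + t * e ^+ n = e ^+ (n - m) * (y + t * e ^+ m).
    by rewrite -{2}(subnK mn) exprD; ring.
  exact: HM.
have [N LN] : exists N, forall n, L n `<=` L N.
  have Umod : is_submodule T (\bigcup_n L n).
    split=> [|x y [m _ mx] [n _ ny]|a x Ta [m _ mx]].
    - by exists 0%N => //; case: (Lmod 0%N).
    - exists (maxn m n) => //; case: (Lmod (maxn m n)) => _ + _; apply.
        by apply: Lle mx; exact: leq_maxl.
      by apply: Lle ny; exact: leq_maxr.
    - by exists m => //; case: (Lmod m) => _ _; apply.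
  have [|u [uU genU]] := noethT _ _ Umod; first by move=> x [n _ []].
  have [N uN] : exists N, forall x, x \in u -> L N x.
    elim: u uU {genU} => [|x u IHu] uU; first by exists 0%N.
    have [|N uN] := IHu; first by move=> y yu; apply: uU; rewrite inE yu orbT.
    have [m _ mx] := uU x (mem_head _ _).
    exists (maxn m N) => y; rewrite inE => /orP[/eqP ->|/uN Ny].
      by apply: Lle mx; exact: leq_maxl.
    by apply: Lle Ny; exact: leq_maxr.
  exists N => n x nx; apply: (lin_comb_sub (Lmod N) uN).
  by apply: genU; exists n.
(* [good s m]: each leading coefficient in [L m] is realized in formal degree [m] by a combination
   of [s]. *)
pose good s m := forall c, L m c ->
  exists2 y, adjoin_lt m y & lin_comb adjoin s (y + c * e ^+ m).
have good_ex m : exists s, (forall x, x \in s -> H x) /\ good s m.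
  have [|u [uL genL]] := noethT (L m) _ (Lmod m); first by move=> x [].
  have [s [sH us]] : exists s, (forall x, x \in s -> H x) /\ forall c, c \in u ->
      exists2 y, adjoin_lt m y & lin_comb adjoin s (y + c * e ^+ m).
    elim: u uL {genL} => [|c u IHu] uL; first by exists [::].
    have [|s [sH us]] := IHu; first by move=> y yu; apply: uL; rewrite inE yu orbT.
    have [_ [y my Hy]] := uL c (mem_head _ _).
    exists (y + c * e ^+ m :: s); split=> [x|d].
      by rewrite inE => /orP[/eqP -> //|]; exact: sH.
    rewrite inE => /orP[/eqP ->|/us[z mz sz]].
      by exists y => //; apply: lin_comb_mem => //; exact: mem_head.
    exists z => //; exists 0, (z + d * e ^+ m).
    by split; [exact: subring0|done|ring].
  exists s; split=> // c /genL; suff gmod : is_submodule T [set c | exists2 y,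
    adjoin_lt m y & lin_comb adjoin s (y + c * e ^+ m)].
    exact: (lin_comb_sub gmod us).
  have [l0 lD lM] := lin_comb_submodule s sA.
  split=> [|t v [y my ly] [z mz lz]|a t Ta [y my ly]].
  - by exists 0; [exact: adjoin_lt0|rewrite mul0r addr0].
  - exists (y + z); first exact: adjoin_ltD.
    have -> : y + z + (t + v) * e ^+ m = (y + t * e ^+ m) + (z + v * e ^+ m) by ring.
    exact: lD.
  - exists (a * y); first exact: adjoin_ltZ.
    have -> : a * y + a * t * e ^+ m = a * (y + t * e ^+ m) by ring.
    by apply: lM => //; exact: sub_adjoin.
have sub_lc s s' : (forall x, x \in s -> x \in s') ->
    lin_comb adjoin s `<=` lin_comb adjoin s'.
  move=> ss'; apply: lin_comb_sub; first exact: lin_comb_submodule.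
  by move=> x /ss'; exact: lin_comb_mem.
(* As every [L n] is contained in [L N], the levels up to [N] suffice. *)
have [s [sH sgood]] : exists s, (forall x, x \in s -> H x) /\
    forall m, (m < N.+1)%N -> good s m.
  elim: N.+1 => [|n [s [sH sgood]]]; first by exists [::].
  have [u [uH ugood]] := good_ex n.
  exists (s ++ u); split=> [x|m]; first by rewrite mem_cat => /orP[/sH|/uH].
  rewrite ltnS leq_eqVlt => /orP[/eqP -> c /ugood[y my ly]|mn c /(sgood m mn)[y my ly]];
    by exists y => //; apply: sub_lc ly => x xs; rewrite mem_cat xs ?orbT.
exists s; split=> // h Hh; have [n _ nh] := HA h Hh.
have lmod := lin_comb_submodule s sA.
elim: n h nh Hh => [|n IHn] h; first by move=> -> _; case: lmod.
move=> [y [t [ny Tt hE]]] Hh; have Lnt : L n t by split=> //; exists y; rewrite -?hE.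
have [m mn [mN Lmt]] : exists2 m, (m <= n)%N & (m <= N)%N /\ L m t.
  have [nN|/ltnW Nn] := leqP n N; first by exists n.
  by exists N => //; split=> //; exact: LN Lnt.
have [z mz lz] := sgood m mN t Lmt.
have [l0 lD lM] := lmod.
(* Subtracting a shifted combination of [s] with the same leading coefficient lowers the formal
   degree of [h]. *)
have eN : e ^+ n = e ^+ (n - m) * e ^+ m by rewrite -exprD subnK.
have -> : h = (y - e ^+ (n - m) * z) + e ^+ (n - m) * (z + t * e ^+ m).
  by rewrite hE eN; ring.
apply: lD; last exact: lM.
apply: IHn.
  by apply: adjoin_ltB => //; rewrite -(subnKC mn) addKn; exact: adjoin_ltX.
have -> : y - e ^+ (n - m) * z = h - e ^+ (n - m) * (z + t * e ^+ m).
  by rewrite hE eN; ring.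
have lH : lin_comb adjoin s `<=` H by exact: lin_comb_sub.
rewrite -mulN1r; apply: HD => //; apply: (HM); first by apply: subringN => //; case: sA.
by apply: HM => //; exact: lH.
Qed.

End Adjoin.
End HilbertBasis.

(** * The Artin-Rees lemma for bigraded algebras *)

(** Coefficients of the component of bidegree [(k, j)] in the [R]-subalgebra of [R[u, v]] generated
    by the [x u^a v^b] with [(a, b, x)] in [G]. The same element of [R] may occur in several
    bidegrees. *)
Inductive bigraded_alg (R : comPzRingType) (G : seq (nat * nat * R)) :
    nat -> nat -> R -> Prop :=
| bigraded_alg0 k j : bigraded_alg G k j 0
| bigraded_algC r : bigraded_alg G 0 0 r
| bigraded_algD k j x y : bigraded_alg G k j x -> bigraded_alg G k j y ->
    bigraded_alg G k j (x + y)
| bigraded_algM k j x g : bigraded_alg G k j x -> g \in G ->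
    bigraded_alg G (k + g.1.1) (j + g.1.2) (x * g.2).

Section BigradedAlgebra.
Context {R : comPzRingType} (G : seq (nat * nat * R)).
Local Notation B := (bigraded_alg G).

Lemma bigraded_alg_mul k j x k' j' y :
  B k j x -> B k' j' y -> B (k + k')%N (j + j')%N (x * y).
Proof.
move=> Bx; elim=> [{}k' {}j'|r|{}k' {}j' u v _ IHu _ IHv|{}k' {}j' u g _ IHu gG].
- by rewrite mulr0; exact: bigraded_alg0.
- rewrite !addn0; elim: Bx => [{}k {}j|s|{}k {}j u v _ IHu _ IHv|{}k {}j u g _ IHu gG].
  + by rewrite mul0r; exact: bigraded_alg0.
  + exact: bigraded_algC.
  + by rewrite mulrDl; exact: bigraded_algD.
  + by rewrite mulrAC; exact: bigraded_algM.
- by rewrite mulrDr; exact: bigraded_algD.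
- by rewrite mulrA !addnA; exact: bigraded_algM.
Qed.

Lemma bigraded_algZ k j r x : B k j x -> B k j (r * x).
Proof. by move/(bigraded_alg_mul (bigraded_algC G r)). Qed.

Lemma bigraded_alg_gen g : g \in G -> B g.1.1 g.1.2 g.2.
Proof. by move=> gG; rewrite -[g.2]mul1r; exact: (bigraded_algM (bigraded_algC G 1)). Qed.

Lemma bigraded_alg_pow (M : ideal R) (s : seq R) j y :
  (forall L : ideal R, (forall b, b \in s -> b \isin L) -> M `<=` L) ->
  (forall b, b \in s -> (0%N, 1%N, b) \in G) ->
  y \isin ideal_pow M j -> B 0 j y.
Proof.
move=> genM sG; have iG i : is_ideal (B 0 i).
  split=> [|u v|a u]; [exact: bigraded_alg0|exact: bigraded_algD|exact: bigraded_algZ].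
elim: j y => [|j IHj] y; first by move=> _; exact: bigraded_algC.
apply: (@ideal_pow_ind _ _ _ (Ideal (iG j.+1))) => u v Mu Mv /=.
rewrite -add1n -[0%N]addn0; apply: bigraded_alg_mul; last exact: IHj.
by apply: (genM (Ideal (iG 1%N))) Mu => b /sG /bigraded_alg_gen.
Qed.

End BigradedAlgebra.

Section ArtinRees.
Context {R : comNzRingType} (noethR : noetherian R) (G : seq (nat * nat * R)).
Local Notation B := (bigraded_alg G).
Local Notation E := {poly {poly R}}.

(** The monomial [r u^k v^j] of [R[u][v]]: bidegrees are realized in an actual ring, to which
    Hilbert's basis theorem applies. *)
Definition bimonomial k j (r : R) : E := (r *: 'X^k)%:P * 'X^j.

Lemma coef_bimonomial k j r k' j' :
  (bimonomial k j r)`_j'`_k' = if (j' == j) && (k' == k) then r else 0.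
Proof.
rewrite /bimonomial coefCM coefXn; have [_|_] := eqVneq j' j; last by rewrite mulr0 coef0.
by rewrite mulr1 coefZ coefXn /=; case: eqP => _; rewrite ?mulr1 ?mulr0.
Qed.

Lemma bimonomialM k j r k' j' r' :
  bimonomial k j r * bimonomial k' j' r' = bimonomial (k + k') (j + j') (r * r').
Proof.
by rewrite /bimonomial !exprD mulrACA -polyCM -scalerAl -scalerAr scalerA.
Qed.

Lemma bimonomialD k j r r' : bimonomial k j (r + r') = bimonomial k j r + bimonomial k j r'.
Proof. by rewrite /bimonomial scalerDl polyCD mulrDl. Qed.

Definition rees_set : set E := [set p : E | forall k j, B k j p`_j`_k].

Lemma rees_subring : is_subring rees_set.
Proof.
split=> [k j|p q Bp Bq k j|p q Bp Bq k j].
- have -> : (1 : E) = bimonomial 0 0 1.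
    by rewrite /bimonomial !expr0 mulr1 scale1r.
  rewrite coef_bimonomial; case: ifP => [/andP[/eqP -> /eqP ->]|_].
    exact: bigraded_algC.
  exact: bigraded_alg0.
- rewrite !coefB -mulN1r; apply: bigraded_algD => //.
  exact: bigraded_algZ.
- rewrite coefM coef_sum; elim/big_ind: _ => [|x y|i _].
  + exact: bigraded_alg0.
  + exact: bigraded_algD.
  rewrite coefM; elim/big_ind: _ => [|x y|l _].
  + exact: bigraded_alg0.
  + exact: bigraded_algD.
  have := bigraded_alg_mul (Bp l i) (Bq (k - l)%N (j - i)%N).
  by rewrite !subnKC ?leq_ord.
Qed.

(** The generators are adjoined to the constants one at a time, which makes the result noetherian;
    [rees_set] bounds it coefficientwise. *)
Definition rees_alg : set E :=
  foldr (fun g T => adjoin T (bimonomial g.1.1 g.1.2 g.2))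
    [set bimonomial 0 0 r | r in [set: R]] G.

Lemma constants_noetherian :
  noetherian_subring [set bimonomial 0 0 r | r in [set: R]].
Proof.
have sub : is_subring [set bimonomial 0 0 r | r in [set: R]].
  split=> [|_ _ [r _ <-] [s _ <-]|_ _ [r _ <-] [s _ <-]].
  - by exists 1; rewrite // /bimonomial !expr0 mulr1 scale1r.
  - exists (r - s) => //; rewrite bimonomialD /bimonomial scaleNr polyCN mulNr //.
  - by exists (r * s); rewrite // bimonomialM.
split=> // H HT [H0 HD HM].
have iI : is_ideal [set r | H (bimonomial 0 0 r)].
  split=> [|x y Hx Hy|a x Hx] /=.
  - by rewrite /bimonomial scale0r mul0r.
  - by rewrite bimonomialD; exact: HD.
  - by rewrite -[0%N]addn0 -bimonomialM; apply: HM => //; exists a.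
have [s [sI genI]] := noetherian_fg noethR (Ideal iI).
exists (map (bimonomial 0 0) s); split=> [_ /mapP[x xs ->]|h Hh]; first exact: sI.
have [r _ rh] := HT h Hh.
have [l0 lD lM] := lin_comb_submodule (map (bimonomial 0 0) s) sub.
have iL : is_ideal [set r | lin_comb [set bimonomial 0 0 r | r in [set: R]]
                             (map (bimonomial 0 0) s) (bimonomial 0 0 r)].
  split=> [|x y Hx Hy|a x Hx] /=.
  - by rewrite /bimonomial scale0r mul0r.
  - by rewrite bimonomialD; exact: lD.
  - by rewrite -[0%N]addn0 -bimonomialM; apply: lM => //; exists a.
rewrite -rh; apply: (genI (Ideal iL)); last by rewrite /= rh.
by move=> x xs /=; apply: lin_comb_mem => //; exact: map_f.
Qed.

Lemma rees_alg_noetherian : noetherian_subring rees_alg.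
Proof.
rewrite /rees_alg; elim: G => [|g s IHs] /=; first exact: constants_noetherian.
by apply: hilbert_basis => //; case: IHs.
Qed.

Lemma rees_alg_sub : rees_alg `<=` rees_set.
Proof.
rewrite /rees_alg; have : forall g, g \in G -> g \in G by [].
elim: {1 3}G => [_ _ [r _ <-]|g s IHs sG] /=.
  move=> k j; rewrite coef_bimonomial; case: ifP => [/andP[/eqP -> /eqP ->]|_].
    exact: bigraded_algC.
  exact: bigraded_alg0.
apply: adjoin_min; first exact: rees_subring.
  by apply: IHs => x xs; apply: sG; rewrite inE xs orbT.
move=> k j; rewrite coef_bimonomial; case: ifP => [/andP[/eqP -> /eqP ->]|_].
  by apply: bigraded_alg_gen; apply: sG; exact: mem_head.
exact: bigraded_alg0.
Qed.

Lemma rees_alg_bimonomial k j r : B k j r -> rees_alg (bimonomial k j r).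
Proof.
have [sA _] := rees_alg_noetherian.
elim=> {k j r} [k j|r|k j x y _ IHx _ IHy|k j x g _ IHx gG].
- have -> : bimonomial k j 0 = 0 by rewrite /bimonomial scale0r mul0r.
  exact: subring0.
- rewrite /rees_alg; elim: G => [|g s IHs] /=; first by exists r.
  exact: sub_adjoin.
- by rewrite bimonomialD; exact: subringD.
- rewrite -bimonomialM; apply: subringM => //.
  rewrite /rees_alg; elim: G gG => [//|h s IHs]; rewrite inE => /orP[/eqP ->|/IHs gs] /=.
    apply: adjoin_gen; elim: s {IHs} => [|h' s IHs] /=; first by case: constants_noetherian.
    exact: adjoin_subring.
  exact: sub_adjoin gs.
Qed.

(** [H] is a bigraded ideal; it has finitely many generators, and [c] bounds their degrees in the
    second variable. Hence a homogeneous [r] is a sum of products [g * h] with [h] in [H] of second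
    degree at most [c]; the additively closed set [X] expresses such a sum without writing it
    out. *)
Lemma artin_rees_nz (H : nat -> nat -> set R) :
  (forall k j, H k j `<=` B k j) -> (forall k j, H k j 0) ->
  (forall k j x y, H k j x -> H k j y -> H k j (x + y)) ->
  (forall k j g k' j' h, B k j g -> H k' j' h -> H (k + k')%N (j + j')%N (g * h)) ->
  exists c, forall k j r (X : set R), H k j r ->
    X 0 -> (forall x y, X x -> X y -> X (x + y)) ->
    (forall k' j' g h, (k' <= k)%N -> (j' <= j)%N -> (j' <= c)%N ->
      B (k - k')%N (j - j')%N g -> H k' j' h -> X (g * h)) -> X r.
Proof.
move=> HB H0 HD HM; have [sA noethA] := rees_alg_noetherian.
pose HE := [set p : E | rees_alg p /\ forall k j, H k j p`_j`_k].
have [||s [sH genH]] := noethA HE.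
- by move=> p [].
- split=> [|p q [Ap Hp] [Aq Hq]|t p At [Ap Hp]].
  + by split=> [|k j]; [exact: subring0|rewrite !coef0].
  + by split=> [|k j]; [exact: subringD|rewrite !coefD; exact: HD].
  + split=> [|k j]; first exact: subringM.
    rewrite coefM coef_sum; elim/big_ind: _ => [//||i _]; first exact: HD.
    rewrite coefM; elim/big_ind: _ => [//||l _]; first exact: HD.
    have := HM _ _ _ _ _ _ (rees_alg_sub At l i) (Hp (k - l)%N (j - i)%N).
    by rewrite !subnKC ?leq_ord.
exists (\max_(p <- s) size p)%N => k j r X Hr X0 XD XM.
have Xlc p : lin_comb rees_alg s p -> X p`_j`_k.
  have : forall q, q \in s -> HE q /\ (size q <= \max_(p <- s) size p)%N.
    by move=> q qs; split; [exact: sH|exact: leq_bigmax_seq].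
  elim: {1 3}s p => [p _ ->|q u IHu p uP [t [z [At lz ->]]]]; first by rewrite !coef0.
  rewrite !coefD; apply: (XD); last first.
    by apply: IHu => // q' q'u; apply: uP; rewrite inE q'u orbT.
  have [[Aq Hq] qs] := uP q (mem_head _ _).
  rewrite coefM coef_sum; elim/big_ind: _ => [//||i _]; first exact: XD.
  rewrite coefM; elim/big_ind: _ => [//||l _]; first exact: XD.
  have [ji|ji] := leqP (size q) (j - i).
    by rewrite (nth_default _ ji) coef0 mulr0.
  have ik : (l <= k)%N by rewrite leq_ord.
  have ij : (i <= j)%N by rewrite leq_ord.
  apply: (XM (k - l)%N (j - i)%N); rewrite ?leq_subr ?subKn //.
    exact: leq_trans (ltnW ji) qs.
  exact: rees_alg_sub.
rewrite -[r](_ : (bimonomial k j r)`_j`_k = r); last by rewrite coef_bimonomial !eqxx.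
apply: Xlc; apply: genH; split=> [|k' j'].
  by apply: rees_alg_bimonomial; exact: HB.
by rewrite coef_bimonomial; case: ifP => [/andP[/eqP -> /eqP ->]|].
Qed.

End ArtinRees.

Lemma graded_artin_rees (R : comPzRingType) (G : seq (nat * nat * R))
    (H : nat -> nat -> set R) :
  noetherian R ->
  (forall k j, H k j `<=` bigraded_alg G k j) -> (forall k j, H k j 0) ->
  (forall k j x y, H k j x -> H k j y -> H k j (x + y)) ->
  (forall k j g k' j' h, bigraded_alg G k j g -> H k' j' h ->
    H (k + k')%N (j + j')%N (g * h)) ->
  exists c, forall k j r (X : set R), H k j r ->
    X 0 -> (forall x y, X x -> X y -> X (x + y)) ->
    (forall k' j' g h, (k' <= k)%N -> (j' <= j)%N -> (j' <= c)%N ->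
      bigraded_alg G (k - k')%N (j - j')%N g -> H k' j' h -> X (g * h)) -> X r.
Proof.
have [R0|R1] := eqVneq (1 : R) 0.
  move=> _ _ _ _ _; exists 0%N => k j r X _ X0 _ _.
  by rewrite -[r]mulr1 R0 mulr0.
move=> noethR.
(* A nonzero ring is repackaged as a [comNzRingType], over which [artin_rees_nz] is stated. *)
have [R' eR] : exists R' : comNzRingType, R = R' :> comPzRingType.
  case: R R1 {G H noethR} => T c R1.
  pose S : comPzRingType := GRing.ComPzRing.Pack c.
  pose R' : comNzRingType := HB.pack T c (GRing.PzSemiRing_isNonZero.Build S R1).
  by exists R'; case: c @S R1 @R' => *.
by move: eR G H noethR => -> G H noethR; exact: artin_rees_nz.
Qed.

(** * Lengths and chains of primes *)

Section Length.
Context {R : comPzRingType}.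
Implicit Types (I K L M : ideal R) (n : nat).

(* There is a strictly increasing chain of [n + 1] ideals starting above [I]:
   the length of [R / I] is at least [n]. *)
Fixpoint colength_ge I n : Prop :=
  if n is n'.+1 then
    exists K y, [/\ I `<=` K, y \isin K, ~ y \isin I & colength_ge K n']
  else True.

Lemma colength_ge_sub I K n : I `<=` K -> colength_ge K n -> colength_ge I n.
Proof.
case: n => //= n IK [L [y [KL Ly nKy Ln]]]; exists L, y.
by split=> //; [exact: subset_trans KL|move=> /IK].
Qed.

Lemma colength_ge_full I n : 1 \isin I -> colength_ge I n -> n = 0%N.
Proof. by case: n => // n I1 [K [y [_ _]]] []; exact: ideal_sub1. Qed.

(* Additivity of the length along 0 -> R/(I : x) -> R/I -> R/(I + (x)) -> 0. *)
Lemma colength_ge_split I x n : colength_ge I n ->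
  exists p q, [/\ n = (p + q)%N, colength_ge (ideal_adjoin I x) p
                & colength_ge (colon I x) q].
Proof.
elim: n I => [|n IHn] I; first by exists 0%N, 0%N.
move=> [K [y [IK Ky nIy /IHn[p [q [-> Kp Kq]]]]]].
have IxKx : ideal_adjoin I x `<=` ideal_adjoin K x.
  apply: ideal_adjoin_sub; last exact: ideal_adjoinr.
  exact: subset_trans (@ideal_adjoinl _ _ _).
have [[r Iyr]|nIxy] := pselect (y \isin ideal_adjoin I x); last first.
  exists p.+1, q; split=> //.
    exists (ideal_adjoin K x), y; split=> //; exact: ideal_adjoinl.
  by apply: colength_ge_sub Kq => z /IK.
exists p, q.+1; split=> //; first by rewrite addnS.
  exact: colength_ge_sub Kp.
exists (colon K x), r; split=> //= [z /IK //||Irx].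
- by have := idealB Ky (IK _ Iyr); rewrite opprB addrC subrK.
- by apply: nIy; rewrite -(subrK (r * x) y); exact: idealD.
Qed.

(** Converse of [colength_ge_split]: multiplication by [x] carries a chain of ideals [K] above
    [I : x] to the chain of the [I + K x] between [I] and [I + (x)], which is followed by the chain
    above [I + (x)]. *)
Lemma colength_ge_glue I x p q :
  colength_ge (ideal_adjoin I x) p -> colength_ge (colon I x) q ->
  colength_ge I (p + q).
Proof.
elim: q I => [|q IHq] I Ip.
  by move=> _; rewrite addn0; apply: colength_ge_sub Ip; exact: ideal_adjoinl.
move=> [K [r [IK Kr nIr Kq]]]; rewrite addnS.
have iI' : is_ideal [set z | exists2 k, k \isin K & z - k * x \isin I].
  split=> [|y z [k Kk Iy] [l Kl Iz]|a y [k Kk Iy]].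
  - by exists 0; rewrite ?mul0r ?subr0; exact: ideal0.
  - exists (k + l); first exact: idealD.
    have -> : y + z - (k + l) * x = (y - k * x) + (z - l * x) by ring.
    exact: idealD.
  - exists (a * k); first exact: idealM.
    have -> : a * y - a * k * x = a * (y - k * x) by ring.
    exact: idealM.
exists (Ideal iI'), (r * x); split=> //.
- by move=> y Iy; exists 0; rewrite ?mul0r ?subr0 //; exact: ideal0.
- by exists r => //; rewrite subrr; exact: ideal0.
apply: IHq.
  apply: colength_ge_sub Ip; apply: ideal_adjoin_sub; last exact: ideal_adjoinr.
  by move=> y [k Kk Iy]; exists k.
apply: colength_ge_sub Kq => y [k Kk Iy].
rewrite -(subrK k y); apply: idealD => //; apply: IK => /=.
by rewrite mulrBl.
Qed.

Lemma colength_ge_maximal M n : maximal_ideal M -> colength_ge M n -> (n <= 1)%N.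
Proof.
case: n => // n [M1 maxM] [K [y [MK Ky nMy Kn]]].
rewrite (colength_ge_full _ Kn) //.
have [z Mz] := maxM y nMy; have -> : 1 = z * y - (z * y - 1) :> R by ring.
by apply: idealB; [exact: idealM|exact: MK].
Qed.

Lemma ideal_pow_comaximal I M k :
  1 \isin ideal_add I M -> 1 \isin ideal_add I (ideal_pow M k).
Proof.
move=> [x [y [Ix My xy]]]; elim: k => [|k [u [v [Iu Mv uv]]]].
  by apply: ideal_addr; exact: ideal_pow0.
exists (x + y * u), (y * v); split; [|exact: ideal_powM|].
  by apply: idealD => //; exact: idealM.
by rewrite -addrA -mulrDr -uv mulr1.
Qed.

(* Primes [P_0 < ... < P_n] with [I] inside [P_0] and [P_n] inside [M]. *)
Fixpoint prime_chain_in M n I : Prop :=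
  exists P : ideal R, [/\ prime_ideal P, I `<=` P &
    if n is n'.+1 then exists2 x, ~ x \isin P & prime_chain_in M n' (ideal_adjoin P x)
    else P `<=` M].

Lemma prime_chain_in_sub M n I K :
  I `<=` K -> prime_chain_in M n K -> prime_chain_in M n I.
Proof.
by case: n => [|n] IK [P [pP KP PM]]; exists P; split=> //; exact: subset_trans KP.
Qed.

Lemma prime_chain_in_base M n I : prime_chain_in M n I -> I `<=` M.
Proof.
elim: n I => [|n IHn] I [P [_ IP]]; first exact: subset_trans.
by move=> [x _ /IHn PM]; apply: subset_trans IP _; apply: subset_trans PM;
  exact: ideal_adjoinl.
Qed.

(** By [colength_ge_split], the length at [I] is bounded by those at [I + (x)] and [I : x]. If [I]
    is proper and not prime, both can be made larger than [I]. If [I] is a prime strictly inside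
    [M], an [x] in [M] outside [I] gives a recursion in [k]; its increments have exponent one less,
    since a chain above [I + (x)] extends downwards by [I]. *)
Lemma colength_upper_bound M : noetherian R -> maximal_ideal M ->
  forall I d, ~ prime_chain_in M d.+1 I ->
  exists C, forall k n, colength_ge (ideal_add I (ideal_pow M k)) n ->
    (n <= C * k.+1 ^ d)%N.
Proof.
move=> noethR maxM; apply: (noetherian_ind noethR) => I IH d nchain.
have IKpow K k : I `<=` K ->
    ideal_add I (ideal_pow M k) `<=` ideal_add K (ideal_pow M k).
  move=> IK; apply: ideal_add_sub; last exact: ideal_addr.
  exact: subset_trans (@ideal_addl _ _ _).
have [I1|nI1] := pselect (1 \isin I).
  by exists 0%N => k n /colength_ge_full ->; last exact: ideal_addl.
have [[x [y [Ixy nIx nIy]]]|primeI] := pselect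
    (exists x y, [/\ x * y \isin I, ~ x \isin I & ~ y \isin I]).
  have [||C1 HC1] := IH (ideal_adjoin I x) (@ideal_adjoinl _ _ _) _ d.
  - by move=> /(_ _ (ideal_adjoinr _ _)).
  - by move=> /(prime_chain_in_sub (@ideal_adjoinl _ _ _)).
  have Icolon : I `<=` colon I x by move=> z Iz; exact: idealMr.
  have [||C2 HC2] := IH (colon I x) Icolon _ d.
  - by move=> /(_ y) /=; rewrite mulrC => /(_ Ixy).
  - by move=> /(prime_chain_in_sub Icolon).
  exists (C1 + C2)%N => k n /(colength_ge_split x)[p [q [-> Ip Iq]]].
  rewrite mulnDl; apply: leq_add.
    apply: HC1; apply: colength_ge_sub Ip; apply: ideal_add_sub.
      apply: ideal_adjoin_sub; last exact: ideal_adjoinr.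
      by apply: subset_trans (@ideal_adjoinl _ _ _); exact: ideal_addl.
    by apply: subset_trans (@ideal_adjoinl _ _ _); exact: ideal_addr.
  apply: HC2; apply: colength_ge_sub Iq; apply: ideal_add_sub => z Iz; apply/colonP.
    exact: ideal_addl.
  by apply: ideal_addr; exact: idealMr.
have pI : prime_ideal I.
  split=> [|//|x y Ixy]; first exact: idealP.
  by apply: contrapT => /not_orP[nIx nIy]; apply: primeI; exists x, y.
have [MI|nMI] := pselect (M `<=` I).
  exists 1%N => -[|k] n In.
    by rewrite (colength_ge_full _ In) //; apply: ideal_addr; exact: ideal_pow0.
  apply: (@leq_trans 1); last by rewrite mul1n expn_gt0.
  apply: colength_ge_maximal maxM _; apply: colength_ge_sub In.
  exact: subset_trans (@ideal_addl _ _ _).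
have [x [Mx nIx]] : exists x, x \isin M /\ ~ x \isin I.
  apply: contrapT => nx; apply: nMI => x Mx; apply: contrapT => nIx.
  by apply: nx; exists x.
(* If [I] is not contained in [M], it is comaximal with every power of [M], and all lengths
   vanish. *)
have [IM|nIM] := pselect (I `<=` M); last first.
  have [z [Iz nMz]] : exists z, z \isin I /\ ~ z \isin M.
    apply: contrapT => nz; apply: nIM => z Iz; apply: contrapT => nMz.
    by apply: nz; exists z.
  exists 0%N => k n /colength_ge_full -> //; apply: ideal_pow_comaximal.
  have [u Mu] := maxM.2 z nMz; exists (u * z), (- (u * z - 1)).
  by split; [exact: idealM|exact: idealN|ring].
(* For [d = 0], [I] and [M] would form a chain of two primes. *)
case: d nchain => [|d] nchain.
  case: nchain; exists I; split=> //; exists x => //.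
  by exists M; split=> //; [exact: maximal_prime|exact: ideal_adjoin_sub].
have [||C HC] := IH (ideal_adjoin I x) (@ideal_adjoinl _ _ _) _ d.
- by move=> /(_ _ (ideal_adjoinr _ _)).
- by move=> chain; apply: nchain; exists I; split=> //; exists x.
(* The constant of [I + (x)] serves again: [C (k+2)^d + C (k+1)^(d+1)] is at most
   [C (k+2)^(d+1)]. *)
exists C; elim=> [|k IHk] n In.
  by rewrite (colength_ge_full _ In) //; apply: ideal_addr; exact: ideal_pow0.
have [p [q [-> Ip Iq]]] := colength_ge_split x In.
have pC : (p <= C * k.+2 ^ d)%N.
  apply: HC; apply: colength_ge_sub Ip; apply: ideal_add_sub.
    apply: ideal_adjoin_sub; last exact: ideal_adjoinr.
    by apply: subset_trans (@ideal_adjoinl _ _ _); exact: ideal_addl.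
  by apply: subset_trans (@ideal_adjoinl _ _ _); exact: ideal_addr.
have qC : (q <= C * k.+1 ^ d.+1)%N.
  apply: IHk; apply: colength_ge_sub Iq; apply: ideal_add_sub => z Iz; apply/colonP.
    by apply: ideal_addl; exact: idealMr.
  by apply: ideal_addr; rewrite mulrC; exact: ideal_powM.
have kd : (k.+1 ^ d <= k.+2 ^ d)%N by case: (d) => // e; rewrite leq_exp2r.
move: pC qC; rewrite !expnS; nia.
Qed.
End Length.

(** * Lower bounds for lengths *)

Section LowerBound.
Context {R : comPzRingType}.
Implicit Types (I K L M P : ideal R) (n : nat).

(** Artin-Rees for [P + (x)] and the powers of [M], with the generators of [M] in bidegree [(0, 1)]:
    an element of [M^k] in [P + (x)] is congruent modulo [P] to some [z' x] with [z'] in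
    [M^(k - c)], and [x] cancels modulo [P]. *)
Lemma artin_rees_colon P M x : noetherian R -> (forall z, z * x \isin P -> z \isin P) ->
  exists c, forall k z, z * x \isin ideal_add P (ideal_pow M k) ->
    z \isin ideal_add P (ideal_pow M (k - c)).
Proof.
move=> noethR Px; have [s [sM genM]] := noetherian_fg noethR M.
pose G := [seq (0%N, 1%N, b) | b <- s].
have GM k j y : bigraded_alg G k j y -> y \isin ideal_pow M j.
  elim=> {k j y} [k j|r|k j y z _ My _ Mz|k j y _ _ My /mapP[b bs ->]].
  - exact: ideal0.
  - exact: ideal_pow0.
  - exact: idealD.
  - by rewrite /= addn1 mulrC; apply: ideal_powM => //; exact: sM.
have MG j y : y \isin ideal_pow M j -> bigraded_alg G 0 j y.
  by apply: (bigraded_alg_pow genM) => b' bs; exact: map_f.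
have [||||c AR] := @graded_artin_rees R G
    (fun k j => [set y | bigraded_alg G k j y /\ exists z, y - z * x \isin P]) noethR.
- by move=> k j y [].
- move=> k j; split; first exact: bigraded_alg0.
  by exists 0; rewrite mul0r subr0; exact: ideal0.
- move=> k j y y' [By [z Pz]] [By' [z' Pz']]; split; first exact: bigraded_algD.
  exists (z + z'); have -> : y + y' - (z + z') * x = (y - z * x) + (y' - z' * x) by ring.
  exact: idealD.
- move=> k j g k' j' h Bg [Bh [z Pz]]; split; first exact: bigraded_alg_mul.
  exists (g * z); rewrite -mulrA -mulrBr; exact: idealM.
exists c => k z [p [y [Pp My zxE]]].
have [z' Mz' Pyz'] : exists2 z', z' \isin ideal_pow M (k - c) & y - z' * x \isin P.
  apply: (AR 0%N k y [set u | exists2 z', z' \isin ideal_pow M (k - c) & u - z' * x \isin P]).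
  - split; first exact: MG.
    exists z; have -> : y - z * x = - p by rewrite zxE; ring.
    exact: idealN.
  - by exists 0; [exact: ideal0|rewrite mul0r subr0; exact: ideal0].
  - move=> u u' [v Mv Pv] [v' Mv' Pv']; exists (v + v'); first exact: idealD.
    have -> : u + u' - (v + v') * x = (u - v * x) + (u' - v' * x) by ring.
    exact: idealD.
  - move=> k' j' g h _ j'k j'c /GM Mg [_ [v Pv]]; exists (g * v).
      by apply: idealMr; apply: ideal_pow_le Mg; exact: leq_sub2l.
    by rewrite -mulrA -mulrBr; exact: idealM.
exists (z - z'), z'; split=> //; last by rewrite subrK.
apply: Px; have -> : (z - z') * x = p + (y - z' * x) by rewrite mulrBl zxE; ring.
exact: idealD.
Qed.

(** Pascal's rule adds two contributions modulo powers of [M]: [P + (x)] gives ['C(k, n)] by the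
    shorter chain, and the colon by [x] gives ['C(k, n.+1)] by induction on [k], since by
    [artin_rees_colon] it loses only [c1] powers of [M]. *)
Lemma colength_lower_bound M n I : noetherian R -> ~ 1 \isin M ->
  prime_chain_in M n I ->
  exists c, forall k, colength_ge (ideal_add I (ideal_pow M (c * k).+1)) 'C(k, n).
Proof.
move=> noethR M1; elim: n I => [|n IHn] I [P [pP IP PM]].
  exists 0%N => k; rewrite bin0 mul0n; exists (ideal_pow M 0), 1; split=> //.
  - by move=> x _; exact: ideal_pow0.
  - exact: ideal_pow0.
  - move=> I1; apply: M1; move: I1; apply: ideal_add_sub; last exact: ideal_pow_sub.
    exact: subset_trans PM.
case: PM => x nPx chain; have PM := prime_chain_in_base chain.
have [|c1 AR] := @artin_rees_colon P M x noethR.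
  by case: pP => _ _ pM z /pM[].
have [c2 lowP] := IHn _ chain.
(* Each step in [k] provides [c1] powers for the Artin-Rees loss and [c2] for the bound at
   [P + (x)]. *)
exists (c1 + c2)%N => k.
suff : colength_ge (ideal_add P (ideal_pow M ((c1 + c2) * k).+1)) 'C(k, n.+1).
  apply: colength_ge_sub; apply: ideal_add_sub; last exact: ideal_addr.
  by apply: subset_trans IP _; exact: ideal_addl.
elim: k => [|k IHk]; first by rewrite bin0n.
rewrite binS [('C(k, n.+1) + _)%N]addnC; apply: (@colength_ge_glue _ _ x).
  apply: (@colength_ge_sub _ _ (ideal_add (ideal_adjoin P x)
    (ideal_pow M (c2 * k).+1))); last exact: lowP.
  apply: ideal_adjoin_sub.
    apply: ideal_add_sub => y Py; first by apply: ideal_addl; exact: ideal_adjoinl.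
    by apply: ideal_addr; apply: ideal_pow_le Py; nia.
  by apply: ideal_addl; exact: ideal_adjoinr.
apply: colength_ge_sub IHk => y /colonP/AR; apply: ideal_add_sub.
  exact: ideal_addl.
move=> z Mz; apply: ideal_addr; apply: ideal_pow_le Mz; nia.
Qed.
End LowerBound.

(** * From independent sequences to chains of primes *)

Section Polynomials.
Context {R : comPzRingType} {n : nat} (w : nat -> nat) (a : 'I_n -> R).
Implicit Types (f g : {mpoly R[n]}) (e m : 'X_{1..n}) (l : seq (R * 'X_{1..n})).

Definition mon_eval e : R := \prod_(i < n) a i ^+ e i.

Lemma mon_evalM e e' : mon_eval (mmul e e') = mon_eval e * mon_eval e'.
Proof. by rewrite -big_split; apply: eq_bigr => i _; rewrite cmM exprD. Qed.

Lemma mon_eval1 : mon_eval mone = 1.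
Proof. by rewrite /mon_eval big1 // => i _; rewrite cm1 expr0. Qed.

Lemma wdegM e e' : wdeg w (mmul e e') = (wdeg w e + wdeg w e')%N.
Proof. by rewrite -big_split; apply: eq_bigr => i _; rewrite cmM mulnDr. Qed.

Lemma wdeg1 : wdeg w (mone : 'X_{1..n}) = 0%N.
Proof. by rewrite /wdeg big1 // => i _; rewrite cm1 muln0. Qed.

Lemma pevalEw f (D : {fset 'X_{1..n}}) : (msupp f `<=` D)%fset ->
  peval a f = \sum_(e <- D) f@_e * mon_eval e.
Proof.
move=> fD; rewrite /peval (big_fset_incl _ fD) // => e _ /mcoeff_outdom ->.
by rewrite mul0r.
Qed.

Lemma pevalD f g : peval a (f + g) = peval a f + peval a g.
Proof.
pose D := (msupp f `|` msupp g)%fset.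
rewrite !(@pevalEw _ D) ?fsubsetUl ?fsubsetUr ?msuppD_le // -big_split.
by apply: eq_bigr => e _; rewrite mcoeffD mulrDl.
Qed.

Lemma pevalU c e : peval a << c *g e >> = c * mon_eval e.
Proof. by rewrite (pevalEw msuppU_le) big_seq_fset1 mcoeffUU. Qed.

Lemma initial_form_coef f m :
  (initial_form w f)@_m = if is_least_wdeg w f (wdeg w m) then f@_m else 0.
Proof.
rewrite /initial_form raddf_sum /=.
under eq_bigr do rewrite mcoeffU.
have [fm|fm] := boolP (m \in msupp f); last first.
  rewrite (mcoeff_outdom fm) if_same big_seq_cond big1 // => e /andP[fe _].
  by case: eqP => [em|//]; move: fm; rewrite -em fe.
rewrite big_mkcond (bigD1_seq m) ?fset_uniq //= eqxx big1 ?addr0 // => e /negbTE ->.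
by rewrite if_same.
Qed.

(** Lists of terms, possibly with repeated monomials, stand for polynomials: addition is
    concatenation, and [form_coef] collects the terms of one monomial. *)
Definition form_eval l : R := \sum_(p <- l) p.1 * mon_eval p.2.
Definition form_coef l m : R := \sum_(p <- l | p.2 == m) p.1.

Lemma form_eval_cat l l' : form_eval (l ++ l') = form_eval l + form_eval l'.
Proof. by rewrite /form_eval big_cat. Qed.

Lemma form_coef_cat l l' m : form_coef (l ++ l') m = form_coef l m + form_coef l' m.
Proof. by rewrite /form_coef big_cat. Qed.

Definition form_scale c e l := [seq (c * p.1, mmul e p.2) | p <- l].

Lemma form_eval_scale c e l : form_eval (form_scale c e l) = c * mon_eval e * form_eval l.
Proof.
by rewrite /form_eval big_map mulr_sumr; apply: eq_bigr => p _; rewrite mon_evalM /=; ring.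
Qed.

Lemma mmulI e : injective (mmul e).
Proof.
move=> x y /eqP/cmP xy; apply/eqP/cmP => i.
by have := xy i; rewrite !cmM => /addnI.
Qed.

Lemma form_coef_scale c e l m : form_coef (form_scale c e l) (mmul e m) = c * form_coef l m.
Proof.
rewrite /form_coef big_map mulr_sumr; apply: eq_bigl => p /=.
by rewrite (inj_eq (@mmulI e)).
Qed.

Lemma form_dependent l m : form_eval l = 0 -> form_coef l m = 1 ->
  (forall p, p \in l -> wdeg w m <= wdeg w p.2)%N -> ~ weighted_independent w a.
Proof.
move=> l0 lm lw; have [R0|R1] := eqVneq (1 : R) 0.
  (* Over the zero ring, the coefficient 0 of the zero polynomial is invertible. *)
  move=> indep; case: (indep 0 _ m); first by rewrite /peval msupp0 big_nil.
  by exists 0; rewrite mulr0 R0.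
pose f := \sum_(p <- l) << p.1 *g p.2 >>.
have fE e : f@_e = form_coef l e.
  rewrite raddf_sum /form_coef [RHS]big_mkcond; apply: eq_bigr => p _ /=.
  by rewrite mcoeffU mulrb.
have suppf e : e \in msupp f -> (wdeg w m <= wdeg w e)%N.
  rewrite -mcoeff_neq0 fE /form_coef; apply: contraNT => we.
  by rewrite big_seq_cond big1 // => p /andP[/lw + /eqP pe]; rewrite pe (negbTE we).
have f0 : peval a f = 0.
  rewrite -l0 /f /form_eval; elim: l {l0 lm lw f fE suppf} => [|p l IHl].
    by rewrite !big_nil /peval msupp0 big_nil.
  by rewrite !big_cons pevalD pevalU IHl.
move=> indep; apply: (indep f f0 m); exists 1; rewrite mulr1 initial_form_coef fE lm.
suff -> : is_least_wdeg w f (wdeg w m) by [].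
apply/andP; split; last by apply/allP => e; exact: suppf.
by apply: map_f; rewrite -mcoeff_neq0 fE lm.
Qed.

(** As [1 != 0], an invertible coefficient of an initial form is nonzero, hence belongs to a
    monomial of least weight. *)
Lemma dependent_relation : (1 : R) != 0 -> ~ weighted_independent w a ->
  exists f m, [/\ peval a f = 0, invertible f@_m &
    forall e, e \in msupp f -> (wdeg w m <= wdeg w e)%N].
Proof.
move=> R1 /existsNP[f /not_implyP[f0 /existsNP[m /contrapT fm]]].
exists f, m; move: fm; rewrite initial_form_coef.
case: ifP => [/andP[_ /allP wm] fm|_ [d]]; first by split.
by rewrite mul0r => /esym /eqP; rewrite (negbTE R1).
Qed.

End Polynomials.

(** * Initial coefficients and the extended Rees algebra *)

Section IndependentToChain.
Context {R : comPzRingType} {n : nat} (w : nat -> nat) (a : 'I_n -> R) (K : ideal R).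
Implicit Types (e m : 'X_{1..n}) (l : seq (R * 'X_{1..n})).
Local Notation wdeg := (wdeg w).

(* The coefficients of the initial forms of the polynomials whose value at [a]
   lies in [K]. *)
Lemma initial_coef_subproof :
  is_ideal [set c | exists l m, [/\ forall p, p \in l -> (wdeg m <= wdeg p.2)%N,
    form_eval a l \isin K & form_coef l m = c]].
Proof.
split=> [|c d [l [m [lw Kl <-]]] [l' [m' [lw' Kl' <-]]]|b c [l [m [lw Kl <-]]]].
- exists [::], mone; rewrite /form_eval /form_coef !big_nil; split=> //.
  exact: ideal0.
(* Each list is multiplied by the chosen monomial of the other, so that both chosen monomials become
   [mmul m' m]. *)
- exists (form_scale 1 m' l ++ form_scale 1 m l'), (mmul m' m); split.
  + move=> p; rewrite mem_cat => /orP[] /mapP[q ql ->]; rewrite !wdegM /=.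
      by rewrite leq_add2l; exact: lw.
    by rewrite addnC leq_add2l; exact: lw'.
  + by rewrite form_eval_cat !form_eval_scale; apply: idealD; exact: idealM.
  + by rewrite form_coef_cat form_coef_scale mulmC form_coef_scale !mul1r.
- exists (form_scale b mone l), (mmul mone m); split.
  + by move=> p /mapP[q ql ->]; rewrite !wdegM leq_add2l; exact: lw.
  + by rewrite form_eval_scale; exact: idealM.
  + exact: form_coef_scale.
Qed.

Definition initial_coefs : ideal R := Ideal initial_coef_subproof.

Lemma sub_initial_coefs : K `<=` initial_coefs.
Proof.
move=> x Kx; exists [:: (x, mone)], mone.
rewrite /form_eval /form_coef !big_cons !big_nil /= eqxx mon_eval1 mulr1 !addr0.
by split=> // p; rewrite inE => /eqP ->.
Qed.

Section LocalBound.
Variable M : ideal R.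
Hypothesis initM : initial_coefs `<=` M.

(* The component of degree [k] of the [j]-th power of the ideal generated by
   [M] and [t] in the extended Rees algebra R[t, a_i t^(- w_i)]. *)
Definition rees_power (k j : nat) : set R := [set x | exists2 l,
  forall p, p \in l -> (k <= wdeg p.2)%N /\ p.1 \isin ideal_pow M (j + k - wdeg p.2)
  & x = form_eval a l].

Lemma rees_power0 k j : rees_power k j 0.
Proof. by exists [::]; rewrite /form_eval ?big_nil. Qed.

Lemma rees_powerD k j x y : rees_power k j x -> rees_power k j y -> rees_power k j (x + y).
Proof.
move=> [l lP ->] [l' lP' ->]; exists (l ++ l'); last by rewrite form_eval_cat.
by move=> p; rewrite mem_cat => /orP[/lP|/lP'].
Qed.

Lemma rees_power_term k j u e : (k <= wdeg e)%N -> u \isin ideal_pow M (j + k - wdeg e) ->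
  rees_power k j (u * mon_eval a e).
Proof.
move=> ke Mu; exists [:: (u, e)]; last by rewrite /form_eval big_cons big_nil addr0.
by move=> p; rewrite inE => /eqP ->.
Qed.

Lemma rees_powerM k j x k' j' y :
  rees_power k j x -> rees_power k' j' y -> rees_power (k + k') (j + j') (x * y).
Proof.
move=> [l lP ->] [l' lP' ->]; rewrite /form_eval mulr_suml.
have : forall p, p \in l -> (k <= wdeg p.2)%N /\ p.1 \isin ideal_pow M (j + k - wdeg p.2).
  exact: lP.
elim: {lP} l => [_|p l IHl lP]; first by rewrite big_nil; exact: rees_power0.
rewrite big_cons; apply: rees_powerD; last first.
  by apply: IHl => q ql; apply: lP; rewrite inE ql orbT.
have [kp Mp] := lP p (mem_head _ _).
rewrite mulr_sumr; elim: l' lP' {IHl} => [_|q l' IHl' lP']; first by rewrite big_nil; exact: rees_power0.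
rewrite big_cons; apply: rees_powerD; last first.
  by apply: IHl' => q' ql'; apply: lP'; rewrite inE ql' orbT.
have [kq Mq] := lP' q (mem_head _ _).
have -> : p.1 * mon_eval a p.2 * (q.1 * mon_eval a q.2) =
    (p.1 * q.1) * mon_eval a (mmul p.2 q.2) by rewrite mon_evalM; ring.
apply: rees_power_term; rewrite wdegM; first exact: leq_add.
apply: ideal_pow_le (ideal_powD Mp Mq).
by move: (Defs.wdeg _ _) (Defs.wdeg _ _) => d d'; lia.
Qed.

Lemma rees_power_le k j j' x : (j' <= j)%N -> rees_power k j x -> rees_power k j' x.
Proof.
move=> jj' [l lP ->]; exists l => // p /lP[kp Mp]; split=> //.
by apply: ideal_pow_le Mp; lia.
Qed.

Lemma rees_power_shift k k' x : (k' <= k)%N -> rees_power k 0 x -> rees_power k' 0 x.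
Proof.
move=> kk' [l lP ->]; exists l => // p /lP[kp Mp]; split; first exact: leq_trans kp.
by apply: ideal_pow_le Mp; lia.
Qed.

(** The product of [a_i t^(- w_i)] with [t^(w_i - k')] is [a_i t^(- k')] and lies in the power
    [w_i - k'] of the ideal generated by [M] and [t]; hence [a i] is placed in every bidegree
    [(k', j')] with [k' + j' <= w i]. *)
Definition rees_gens (s : seq R) : seq (nat * nat * R) :=
  [seq (0%N, 1%N, b) | b <- s] ++
  flatten [seq [seq (kj.1, kj.2, a i) | kj <- allpairs pair (iota 0 (w i).+1) (iota 0 (w i).+1)
                & (kj.1 + kj.2 <= w i)%N] | i <- enum 'I_n].

Lemma rees_gens_sub s k j x : (forall b, b \in s -> b \isin M) ->
  bigraded_alg (rees_gens s) k j x -> rees_power k j x.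
Proof.
move=> sM; have const r : rees_power 0 0 r.
  rewrite -[r]mulr1 -(mon_eval1 a); apply: rees_power_term; first by rewrite wdeg1.
  by rewrite wdeg1; exact: ideal_pow0.
elim=> {k j x} [k j|r|k j x y _ Vx _ Vy|k j x g _ Vx gG].
- exact: rees_power0.
- exact: const.
- exact: rees_powerD.
apply: rees_powerM => //; move: gG; rewrite mem_cat => /orP[/mapP[b bs ->] /=|].
  rewrite -[b]mulr1 -(mon_eval1 a); apply: rees_power_term; rewrite wdeg1 //.
  by apply: ideal_pow1; exact: sM.
move=> /flatten_mapP[i _] /mapP[[k' j']]; rewrite mem_filter => /andP[/= kj _] -> /=.
have wU : wdeg (ucm i) = w i.
  rewrite /Defs.wdeg (bigD1 i) //= cmU eqxx muln1 big1 ?addn0 // => i' /negbTE ii'.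
  by rewrite cmU eq_sym ii' muln0.
have -> : a i = 1 * mon_eval a (ucm i).
  rewrite mul1r /mon_eval (bigD1 i) //= cmU eqxx expr1 big1 ?mulr1 // => i' /negbTE ii'.
  by rewrite cmU eq_sym ii' expr0.
apply: rees_power_term; rewrite wU; first lia.
have -> : (j' + k' - w i = 0)%N by lia.
exact: ideal_pow0.
Qed.

(** The weight of a monomial in [a] can be divided freely between the two degrees, factor by factor.
    In a term of weight [d] in bidegree [(k, j)], the coefficient supplies [j + k - d] of the second
    degree and the monomial the rest. *)
Lemma rees_gens_gen s k j x : (forall L : ideal R, (forall b, b \in s -> b \isin L) -> M `<=` L) ->
  rees_power k j x -> bigraded_alg (rees_gens s) k j x.
Proof.
move=> genM; set G := rees_gens s.
have MG i u : u \isin ideal_pow M i -> bigraded_alg G 0 i u.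
  apply: (bigraded_alg_pow genM) => b' bs; rewrite mem_cat; apply/orP; left.
  exact: map_f.
pose good (y : R) (d : nat) := forall k j, (k + j <= d)%N -> bigraded_alg G k j y.
have good1 : good 1 0%N.
  by move=> k' j'; rewrite leqn0 addn_eq0 => /andP[/eqP -> /eqP ->]; exact: bigraded_algC.
have goodM y d z d' : good y d -> good z d' -> good (y * z) (d + d')%N.
  move=> gy gz k' j' kj.
  have := bigraded_alg_mul (gy (minn k' d) (minn j' (d - minn k' d)) _)
    (gz (k' - minn k' d) (j' - minn j' (d - minn k' d)) _)%N.
  by rewrite !subnKC ?geq_minl //; apply; lia.
have good_gen i : good (a i) (w i).
  move=> k' j' kj; apply: (@bigraded_alg_gen _ G (k', j', a i)); rewrite mem_cat.
  apply/orP; right; apply/flatten_mapP; exists i; first by rewrite mem_enum.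
  apply/mapP; exists (k', j') => //; rewrite mem_filter; apply/andP; split=> //.
  by apply: allpairs_f; rewrite mem_iota; lia.
have good_mon e : good (mon_eval a e) (wdeg e).
  apply: (big_rec2 (fun y d => good y d)) => // i d y _ gy; apply: (goodM) => //.
  elim: (e i) => [|q IHq]; first by rewrite muln0 expr0.
  by rewrite exprS mulnS; exact: goodM.
move=> [l lP ->]; rewrite /form_eval; elim: l lP => [_|p l IHl lP].
  by rewrite big_nil; exact: bigraded_alg0.
rewrite big_cons; apply: bigraded_algD; last first.
  by apply: IHl => q ql; apply: lP; rewrite inE ql orbT.
have [kp Mp] := lP p (mem_head _ _).
have := bigraded_alg_mul (MG _ _ Mp) (good_mon p.2 k (minn j (wdeg p.2 - k)) _).
move: kp; move: (Defs.wdeg w p.2) => d kd; rewrite add0n.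
have -> : (j + k - d + minn j (d - k) = j)%N by lia.
by apply; lia.
Qed.

(** The value is moved up in weight modulo [K]: by Artin-Rees, each unit of weight costs at most [c]
    powers. After [wdeg m] steps one power is left, so the new form has its coefficient at [m] in
    [M]. Its difference with the given form has its value in [K], hence a coefficient at [m] in
    [initial_coefs], which lies in [M]. *)
Lemma initial_form_bound : noetherian R -> exists c, forall l m,
  (forall p, p \in l -> (wdeg m <= wdeg p.2)%N) ->
  form_eval a l \isin ideal_add K (ideal_pow M (c * wdeg m).+1) ->
  form_coef l m \isin M.
Proof.
move=> noethR; have [s [sM genM]] := noetherian_fg noethR M.
have sub := rees_gens_sub sM; have gen := rees_gens_gen genM.
(* The second condition says that the element is divisible by [t] modulo [K]. *)
have [||||c AR] := @graded_artin_rees R (rees_gens s) (fun k j =>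
    [set x | rees_power k j x /\ exists2 y, rees_power k.+1 0 y & x - y \isin K]) noethR.
- by move=> k j x [/gen].
- move=> k j; split; first exact: rees_power0.
  by exists 0; [exact: rees_power0|rewrite subr0; exact: ideal0].
- move=> k j x y [Vx [x' Vx' Kx]] [Vy [y' Vy' Ky]]; split; first exact: rees_powerD.
  exists (x' + y'); first exact: rees_powerD.
  have -> : x + y - (x' + y') = (x - x') + (y - y') by ring.
  exact: idealD.
- move=> k j g k' j' h /sub Vg [Vh [y Vy Kh]]; split; first exact: rees_powerM.
  exists (g * y); last by rewrite -mulrBr; exact: idealM.
  by rewrite -addnS -[0%N]addn0; apply: rees_powerM => //; exact: rees_power_le Vg.
exists c => l m lm [x [y [Kx My lxy]]].
pose J := (c * wdeg m).+1.
have Vl : rees_power (wdeg m) 0 (form_eval a l).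
  exists l => // p /lm mp; split=> //.
  by move: mp; rewrite add0n -subn_eq0 => /eqP ->; exact: ideal_pow0.
have [z [Vz Kz]] : exists z, rees_power (wdeg m) (J - c * wdeg m) z /\
    z - form_eval a l \isin K.
  have : (wdeg m <= wdeg m)%N by [].
  elim: {1 3 4}(wdeg m) => [_|d IHd dm].
    exists y; split.
      rewrite -[y]mulr1 -(mon_eval1 a); apply: rees_power_term; first by rewrite wdeg1.
      by rewrite wdeg1 muln0 !subn0 addn0.
    have -> : y - form_eval a l = - x by rewrite lxy; ring.
    exact: idealN.
  have [z [Vz Kz]] := IHd (ltnW dm).
  have [z' [Vz' Kz']] : exists z', rees_power d.+1 (J - c * d.+1) z' /\ z - z' \isin K.
    apply: (AR d (J - c * d)%N z [set u | exists z', rees_power d.+1 (J - c * d.+1) z' /\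
      u - z' \isin K]).
    - split=> //; exists (form_eval a l) => //; exact: rees_power_shift Vl.
    - by exists 0; split; [exact: rees_power0|rewrite subr0; exact: ideal0].
    - move=> u v [u' [Vu Ku]] [v' [Vv Kv]]; exists (u' + v'); split; first exact: rees_powerD.
      have -> : u + v - (u' + v') = (u - u') + (v - v') by ring.
      exact: idealD.
    - move=> k' j' g h k'd j'd j'c /sub Vg [_ [y' Vy' Kh]]; exists (g * y'); split.
        have := rees_powerM Vg Vy'; rewrite addnS subnK // addn0.
        by apply: rees_power_le; lia.
      by rewrite -mulrBr; exact: idealM.
  exists z'; split=> //.
  have -> : z' - form_eval a l = (z - form_eval a l) - (z - z') by ring.
  exact: idealB.
have {}Vz : rees_power (wdeg m) 1 z by apply: rees_power_le Vz; rewrite /J; lia.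
have [l' lP' zE] := Vz.
have Mcoef : form_coef l' m \isin M.
  rewrite /form_coef big_seq_cond; apply: ideal_sum => p /andP[/lP'[_ Mp] /eqP pm].
  by move: Mp; rewrite pm addnK; exact: ideal_pow_sub.
rewrite -(subrK (form_coef l' m) (form_coef l m)); apply: idealD => //.
apply: initM; exists (l ++ form_scale (- 1) mone l'), m; split.
- move=> p; rewrite mem_cat => /orP[/lm //|/mapP[q /lP'[mq _] ->]].
  by rewrite wdegM wdeg1.
- rewrite form_eval_cat form_eval_scale mon_eval1 mulr1 mulN1r -zE -opprB.
  exact: idealN.
- by rewrite form_coef_cat -{2}(mul1m m) form_coef_scale mulN1r.
Qed.

End LocalBound.

End IndependentToChain.

(** * Counting monomials in an independent sequence *)

Lemma colength_ge_list (R : comPzRingType) (T : Type) (x : T -> R) (I : ideal R) (s : seq T) :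
  (forall s1 y s2, s = s1 ++ y :: s2 -> ~ x y \isin foldl ideal_adjoin I (map x s1)) ->
  colength_ge I (size s).
Proof.
elim: s I => // y s IHs I sI; exists (ideal_adjoin I (x y)), (x y); split.
- exact: ideal_adjoinl.
- exact: ideal_adjoinr.
- exact: (sI [::] y s).
- by apply: IHs => s1 z s2 ss; apply: (sI (y :: s1) z s2); rewrite ss.
Qed.

Lemma foldl_adjoinP (R : comPzRingType) (T : Type) (x : T -> R) (I : ideal R) (s : seq T) z :
  z \isin foldl ideal_adjoin I (map x s) ->
  exists l : seq (R * T), map snd l = s /\ z - \sum_(p <- l) p.1 * x p.2 \isin I.
Proof.
elim: s I => [|y s IHs] I /= zI; first by exists [::]; rewrite big_nil subr0.
have [l [ls [r zl]]] := IHs _ zI; exists ((r, y) :: l); rewrite /= ls; split=> //.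
by rewrite big_cons /= opprD [_ + - (\sum_(_ <- _) _)]addrC addrA.
Qed.

Definition box_mon n q (g : {ffun 'I_n -> 'I_q}) : 'X_{1..n} :=
  \big[mmul/mone]_(i < n) iter (g i) (mmul (ucm i)) mone.

Lemma box_monE n q (g : {ffun 'I_n -> 'I_q}) i : box_mon g i = g i :> nat.
Proof.
have iterE k (j : 'I_n) : iter k (mmul (ucm j)) mone i = (k * (j == i))%N.
  by elim: k => [|k IHk]; rewrite /= ?cm1 // cmM cmU IHk mulSn.
rewrite /box_mon (big_morph (fun m : 'X_{1..n} => m i) (fun x y => cmM i x y) (cm1 i)).
rewrite (bigD1 i) //= iterE eqxx muln1 big1 ?addn0 // => j /negbTE ji.
by rewrite iterE ji muln0.
Qed.

Lemma box_mon_inj n q : injective (@box_mon n q).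
Proof.
by move=> g h gh; apply/ffunP => i; apply: val_inj; rewrite /= -!box_monE gh.
Qed.

(** For positive [q], [c q + 2 <= (c + 2) q], which reduces the claim to [C (c + 2)^n < q]. *)
Lemma pow_gt_poly C c n : exists q, (C * (c * q + 2) ^ n < q ^ n.+1)%N.
Proof.
pose q := (C * (c + 2) ^ n).+1; exists q.
have : (C * (c * q + 2) ^ n <= C * ((c + 2) ^ n * q ^ n))%N.
  rewrite -expnMn leq_mul2l; apply/orP; right; case: n @q => // n q.
  by rewrite leq_exp2r // mulnDl leq_add2l leq_pmulr.
move=> /leq_ltn_trans; apply; rewrite mulnA expnS ltn_mul2r ltnSn andbT.
by rewrite expn_gt0.
Qed.

(** For positive [n], list the [q^n] monomials with exponents below [q] by decreasing weight. None
    lies in the ideal generated by the preceding ones, [K] and [M^(c W q + 1)]: otherwise a form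
    with initial coefficient 1 would contradict [initial_form_bound]. Without the chain, this length
    would be bounded by a multiple of [(c W q + 2)^(n - 1)]. *)
Lemma initial_coefs_chain (R : comPzRingType) n (w : nat -> nat) (a : 'I_n -> R) (K M : ideal R) :
  noetherian R -> maximal_ideal M -> initial_coefs w a K `<=` M -> prime_chain_in M n K.
Proof.
move=> noethR maxM initM.
have KM : K `<=` M by exact: subset_trans (@sub_initial_coefs _ _ _ _ _) initM.
case: n => [|n] in a initM *.
  by exists M; split=> //; exact: maximal_prime.
apply: contrapT => /(colength_upper_bound noethR maxM)[C upC].
have [c lowc] := initial_form_bound initM noethR.
pose W := (\sum_(i < n.+1) w i)%N.
have [q] := pow_gt_poly C (c * W) n; rewrite ltnNge => /negP; apply.
pose s := sort (fun e e' => wdeg w e' <= wdeg w e)%N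
  [seq box_mon g | g : {ffun 'I_n.+1 -> 'I_q}].
have -> : (q ^ n.+1 = size s)%N.
  by rewrite size_sort size_map -cardE card_ffun !card_ord.
have su : uniq s by rewrite sort_uniq map_inj_uniq ?enum_uniq //; exact: box_mon_inj.
have sorted_s : sorted (fun e e' => wdeg w e' <= wdeg w e)%N s.
  by apply: sort_sorted => e e'; exact: leq_total.
have sW e : e \in s -> (wdeg w e <= W * q)%N.
  rewrite mem_sort => /mapP[g _ ->]; rewrite /Defs.wdeg /W big_distrl /=.
  by apply: leq_sum => i _; rewrite box_monE leq_mul2l (ltnW (ltn_ord _)) orbT.
rewrite addn2.
apply: upC; apply: (@colength_ge_list _ _ (mon_eval a)) => s1 e s2 sE.
move=> /foldl_adjoinP[l [ls Kl]].
have [M1 _] := maxM; apply: M1.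
have l1 : form_coef ((1, e) :: form_scale (-1) mone l) e = 1.
  rewrite /form_coef big_cons /= eqxx /form_scale big_map big_seq_cond big1 ?addr0 //.
  move=> p /andP[pl /=]; rewrite mul1m => /eqP pe.
  have : e \in s1 by rewrite -ls; apply/mapP; exists p.
  by move: su; rewrite sE cat_uniq /= => /and3P[_ /norP[/negbTE ->]].
rewrite -l1; apply: lowc.
  move=> p; rewrite inE => /orP[/eqP -> //|/mapP[p' p'l ->]].
  rewrite wdegM wdeg1 add0n; have ps1 : p'.2 \in s1 by rewrite -ls; exact: map_f.
  have tr : transitive (fun e e' : 'X_{1..n.+1} => wdeg w e' <= wdeg w e)%N.
    by move=> e1 e2 e3 h1 h2; exact: leq_trans h2 h1.
  move: sorted_s; rewrite sE sorted_pairwise // pairwise_cat => /and3P[/allrelP h _ _].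
  by apply: h => //; exact: mem_head.
move: Kl; rewrite -/(form_eval a l).
have -> : form_eval a ((1, e) :: form_scale (-1) mone l) = mon_eval a e - form_eval a l.
  rewrite -cat1s form_eval_cat form_eval_scale mon_eval1 /form_eval big_cons big_nil /=.
  by ring.
apply: ideal_add_sub; [exact: ideal_addl|move=> x Mx; apply: ideal_addr].
apply: ideal_pow_le Mx; rewrite ltnS -mulnA leq_mul2l; apply/orP; right.
by apply: sW; rewrite sE mem_cat mem_head orbT.
Qed.

(** * From chains of primes to independent sequences *)

Section MonomialSpan.
Context {R : comPzRingType} {r : nat} (b : 'I_r -> R) (M : ideal R).
Hypothesis bM : forall i, b i \isin M.
Hypothesis genM : forall L : ideal R, (forall i, b i \isin L) -> M `<=` L.
Implicit Types (e h : 'I_r -> nat).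

Definition gen_mon e : R := \prod_i b i ^+ e i.
Definition gen_deg e : nat := (\sum_i e i)%N.

Lemma gen_monD e h : gen_mon (fun i => e i + h i)%N = gen_mon e * gen_mon h.
Proof. by rewrite -big_split; apply: eq_bigr => i _; rewrite exprD. Qed.

Lemma gen_degD e h : gen_deg (fun i => e i + h i)%N = (gen_deg e + gen_deg h)%N.
Proof. exact: big_split. Qed.

Lemma eq_gen_mon e h : e =1 h -> gen_mon e = gen_mon h.
Proof. by move=> eh; apply: eq_bigr => i _; rewrite eh. Qed.

Lemma eq_gen_deg e h : e =1 h -> gen_deg e = gen_deg h.
Proof. by move=> eh; apply: eq_bigr => i _; rewrite eh. Qed.

Lemma gen_mon_unit i : gen_mon (fun j => (j == i) : nat) = b i.
Proof.
rewrite /gen_mon (bigD1 i) //= eqxx expr1 big1 ?mulr1 // => j /negbTE ->.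
by rewrite expr0.
Qed.

Lemma gen_deg_unit i : gen_deg (fun j => (j == i) : nat) = 1%N.
Proof. by rewrite /gen_deg (bigD1 i) //= eqxx big1 // => j /negbTE ->. Qed.

Lemma leq_gen_deg e i : (e i <= gen_deg e)%N.
Proof. by rewrite /gen_deg (bigD1 i) //= leq_addr. Qed.

Lemma gen_mon_pow e : gen_mon e \isin ideal_pow M (gen_deg e).
Proof.
apply: (big_rec2 (fun x d => x \isin ideal_pow M d)); first exact: ideal_pow0.
by move=> i d x _ Mx; apply: ideal_powD => //; exact: ideal_pow_exp.
Qed.

Lemma ideal_pow_gen j (L : ideal R) :
  (forall e, gen_deg e = j -> gen_mon e \isin L) -> ideal_pow M j `<=` L.
Proof.
elim: j L => [|j IHj] L HL.
  have L1 : 1 \isin L.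
    have -> : 1 = gen_mon (fun=> 0%N) by rewrite /gen_mon big1 // => i _; rewrite expr0.
    by apply: HL; rewrite /gen_deg big1.
  by move=> x _; exact: ideal_sub1.
apply: ideal_pow_ind => x y Mx My.
suff : M `<=` colon L y by apply.
apply: genM => i; suff : ideal_pow M j `<=` colon L (b i).
  by move=> /(_ y My) /=; rewrite mulrC.
apply: IHj => e ej /=; rewrite -gen_mon_unit -gen_monD.
by apply: HL; rewrite gen_degD gen_deg_unit ej addn1.
Qed.

End MonomialSpan.

(** * Counting standard monomials *)

Section Counting.

(** Each adjoined element is killed by [M] modulo the preceding ones, so it adds at most 1 to the
    length; outside [std] it already lies in the ideal and adds nothing. *)
Lemma colength_le_list (R : comPzRingType) (M : ideal R) (T : Type) (x : T -> R)
    (std : pred T) (I : ideal R) (s : seq T) n :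
  maximal_ideal M ->
  (forall s1 y s2, s = s1 ++ y :: s2 ->
     (forall z, z \isin M -> z * x y \isin foldl ideal_adjoin I (map x s1)) /\
     (~~ std y -> x y \isin foldl ideal_adjoin I (map x s1))) ->
  1 \isin foldl ideal_adjoin I (map x s) -> colength_ge I n -> (n <= count std s)%N.
Proof.
move=> maxM; elim: s I n => [|y s IHs] I n sI /= I1 In.
  by rewrite (colength_ge_full I1 In).
have [My stdy] := sI [::] y s erefl.
have IHI m : colength_ge (ideal_adjoin I (x y)) m -> (m <= count std s)%N.
  by apply: IHs I1 => s1 z s2 ss; apply: (sI (y :: s1) z s2); rewrite ss.
have [_|/stdy /= Iy] := boolP (std y); last first.
  apply: IHI; apply: colength_ge_sub In; apply: ideal_adjoin_sub => //.
have [p [q [-> Ip Iq]]] := colength_ge_split (x y) In.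
rewrite addnC leq_add ?IHI //; apply: colength_ge_maximal maxM _.
exact: colength_ge_sub Iq.
Qed.

Lemma foldl_adjoin_sub (R : comPzRingType) (I : ideal R) (s : seq R) :
  I `<=` foldl ideal_adjoin I s.
Proof.
by elim: s I => [|x s IHs] I y Iy //; apply: IHs; exact: ideal_adjoinl.
Qed.

Lemma foldl_adjoin_mem (R : comPzRingType) (I : ideal R) (s : seq R) x :
  x \in s -> x \isin foldl ideal_adjoin I s.
Proof.
elim: s I => //= y s IHs I; rewrite inE => /orP[/eqP ->|/IHs //].
by apply: foldl_adjoin_sub; exact: ideal_adjoinr.
Qed.

Lemma digits_inj r K (e h : 'I_r -> nat) :
  (forall i, e i < K)%N -> (forall i, h i < K)%N ->
  (\sum_i e i * K ^ i = \sum_i h i * K ^ i)%N -> e =1 h.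
Proof.
elim: r e h => [|r IHr] e h eK hK; first by move=> _ [].
have K0 : (0 < K)%N by exact: leq_ltn_trans (eK ord0).
have recl (g : 'I_r.+1 -> nat) : (\sum_i g i * K ^ i =
    (\sum_(i < r) g (lift ord0 i) * K ^ i) * K + g ord0)%N.
  rewrite big_ord_recl expn0 muln1 addnC; congr (_ + _)%N.
  rewrite big_distrl; apply: eq_bigr => i _.
  by rewrite -[RHS]mulnA -expnSr.
rewrite !recl => eh.
have e0 : e ord0 = h ord0.
  by have := congr1 (modn^~ K) eh; rewrite !modnMDl !modn_small.
have {}eh : (\sum_(i < r) e (lift ord0 i) * K ^ i = \sum_(i < r) h (lift ord0 i) * K ^ i)%N.
  by have := congr1 (divn^~ K) eh; rewrite !divnMDl // !divn_small // !addn0.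
move=> i; case: (unliftP ord0 i) => [j ->|-> //].
exact: (IHr (fun i => e (lift ord0 i)) (fun i => h (lift ord0 i))).
Qed.

(** A vector [g] is encoded by the set of its large places, its small values, and the list of its at
    most [n] large values. *)
Lemma card_few_large r n D k :
  (#|[pred g : {ffun 'I_r -> 'I_k.+1} | #|[pred i | (D < g i)%N]| <= n]| <=
    2 ^ r * D.+1 ^ r * k.+1 ^ n)%N.
Proof.
pose large (g : {ffun 'I_r -> 'I_k.+1}) := [set i | (D < g i)%N]%SET.
pose code (g : {ffun 'I_r -> 'I_k.+1}) :=
  (large g, [ffun i => inord (g i) : 'I_D.+1],
   [ffun t : 'I_n => nth ord0 [seq g i | i <- enum (large g)] t]).
have -> : (2 ^ r * D.+1 ^ r * k.+1 ^ n)%N =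
    #|{: {set 'I_r} * {ffun 'I_r -> 'I_D.+1} * {ffun 'I_n -> 'I_k.+1}}|.
  have -> : (2 ^ r = #|{: {set 'I_r}}|)%N.
    by rewrite -cardsT -powersetT card_powerset cardsT card_ord.
  by rewrite !card_prod !card_ffun !card_ord.
rewrite -(card_in_imset (f := code)); first exact: max_card.
rewrite /code => g h; rewrite !inE -!(cardsE (fun i => _ < _)%N) => gn hn [lgh low high]; apply/ffunP => i; apply: val_inj.
have [il|il] := boolP (i \in large g); last first.
  have ig : (g i < D.+1)%N by move: il; rewrite inE -leqNgt.
  have ih : (h i < D.+1)%N by move: il; rewrite lgh inE -leqNgt.
  have := congr1 (fun f : {ffun 'I_r -> 'I_D.+1} => val (f i)) low.
  by rewrite !ffunE /= !inordK.
have ilt : (index i (enum (large g)) < #|large g|)%N by rewrite cardE index_mem mem_enum.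
have := congr1 (fun f : {ffun 'I_n -> 'I_k.+1} => val (f (Ordinal (leq_trans ilt gn)))) high.
rewrite !ffunE /= !(nth_map i) -?lgh ?index_mem ?mem_enum //.
by rewrite nth_index ?mem_enum.
Qed.

End Counting.

Section ChainToIndependent.

Lemma seq_argmax (T : eqType) (s : seq T) (A : T -> Prop) (key : T -> nat) :
  (exists2 x, x \in s & A x) ->
  exists x, [/\ x \in s, A x & forall y, y \in s -> A y -> (key y <= key x)%N].
Proof.
elim: s => [[]//|x s IHs] [z zs Az].
have [/IHs[y [ys Ay maxy]]|ns] := pselect (exists2 y, y \in s & A y).
  have [[Ax /ltnW xy]|nx] := pselect (A x /\ (key y < key x)%N).
    exists x; split; rewrite ?mem_head // => t; rewrite inE => /orP[/eqP -> //|ts At].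
    exact: leq_trans (maxy t ts At) xy.
  exists y; split; rewrite // ?inE ?ys ?orbT // => t; rewrite inE => /orP[/eqP -> At|//].
    by rewrite leqNgt; apply/negP => xy; apply: nx.
  exact: maxy.
move: zs; rewrite inE => /orP[/eqP zx|zs]; last by case: ns; exists z.
exists x; split; rewrite ?mem_head -?zx // => t; rewrite inE => /orP[/eqP -> //|ts At].
by case: ns; exists t.
Qed.

(** With [k = n + q], the falling factorial of [k] is at least [q^(n + 1)], and [n.+1] factorial is
    absorbed into the constant. *)
Lemma bin_gt_poly C c n : exists k, (C * (c * k).+1 ^ n < 'C(k, n.+1))%N.
Proof.
have [q Hq] := pow_gt_poly (C * n.+1`!) (c * n + c) n.
have q0 : (0 < q)%N by case: q Hq => //; rewrite exp0n.
exists (n + q)%N; rewrite -(ltn_pmul2r (fact_gt0 n.+1)) bin_ffact.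
apply: (@leq_ltn_trans (C * n.+1`! * ((c * n + c) * q + 2) ^ n)).
  rewrite mulnAC leq_mul2l; apply/orP; right.
  case: n {Hq} => // n; rewrite leq_exp2r //; nia.
apply: leq_trans Hq _.
have le m p : (q + m <= p)%N -> (q ^ m.+1 <= p ^_ m.+1)%N.
  elim: m p => [|m IHm] p; first by rewrite addn0 expn1 ffactn1.
  case: p => [|p]; first by rewrite addnS.
  rewrite addnS ltnS => mp; rewrite ffactnS expnS leq_mul ?IHm //.
  by apply: leq_trans (leqW mp); exact: leq_addr.
by apply: le; rewrite addnC.
Qed.

Context {R : comPzRingType} {r n : nat} (b : 'I_r -> R) (M Q : ideal R).
Hypothesis bM : forall i, b i \isin M.
Hypothesis genM : forall L : ideal R, (forall i, b i \isin L) -> M `<=` L.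
Hypothesis maxM : maximal_ideal M.

Local Notation mon := (gen_mon b).

(* A nontrivial relation modulo [M^(d+1) + Q] between monomials of degree [d]
   in the variables selected by [sigma]. *)
Definition form_relation (sigma : 'I_n -> 'I_r) (d : nat) : Prop :=
  exists l : seq (R * {ffun 'I_r -> nat}),
  [/\ uniq (map snd l),
      forall p, p \in l -> gen_deg p.2 = d /\ forall i, (forall t, sigma t != i) -> p.2 i = 0%N,
      \sum_(p <- l) p.1 * mon p.2 \isin ideal_add Q (ideal_pow M d.+1)
    & exists2 p, p \in l & ~ p.1 \isin M].

(** A key for comparing monomials of one degree: additive, hence compatible with multiplication, and
    injective on exponents below [K]. *)
Definition digits K (e : 'I_r -> nat) : nat := (\sum_i e i * K ^ i)%N.

Lemma digitsD K e h : digits K (fun i => e i + h i)%N = (digits K e + digits K h)%N.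
Proof. by rewrite -big_split; apply: eq_bigr => i _; rewrite mulnDl. Qed.

Lemma eq_digits K e h : e =1 h -> digits K e = digits K h.
Proof. by move=> eh; apply: eq_bigr => i _; rewrite eh. Qed.

Lemma digits_le K e : (0 < K)%N -> (digits K e <= gen_deg e * K ^ r)%N.
Proof.
move=> K0; rewrite /gen_deg big_distrl; apply: leq_sum => i _.
by rewrite leq_mul2l leq_pexp2l ?orbT // ltnW.
Qed.

(* The monomial [e] of largest key with a coefficient outside [M] is a
   combination of smaller ones, and so are all its multiples. *)
Lemma leading_monomial sigma d K : form_relation sigma d -> (d < K)%N ->
  exists e : 'I_r -> nat, [/\ gen_deg e = d, forall i, (forall t, sigma t != i) -> e i = 0%N
  & forall (h : 'I_r -> nat) (L : ideal R), Q `<=` L -> ideal_pow M (d + gen_deg h).+1 `<=` L ->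
      (forall e' : 'I_r -> nat, gen_deg e' = d -> (digits K e' < digits K e)%N ->
         mon (fun i => e' i + h i)%N \isin L) ->
      mon (fun i => e i + h i)%N \isin L].
Proof.
move=> [l [ul lP lQ lM]] dK.
have [p [pl nMp maxp]] := seq_argmax (fun q : R * {ffun 'I_r -> nat} => digits K q.2) lM.
have [pd ps] := lP p pl; exists p.2; split=> // h L QL ML HL.
(* A coefficient in [M] raises the power of [M]; with any other coefficient the monomial has a
   smaller key. *)
have others q : q \in l -> q != p -> q.1 * mon (fun i => q.2 i + h i)%N \isin L.
  move=> ql qp; have [qd _] := lP q ql.
  have [Mq|nMq] := pselect (q.1 \isin M).
    apply: ML; apply: ideal_powM => //.
    by rewrite -qd -gen_degD; exact: gen_mon_pow.
  apply/idealM/HL => //; rewrite ltn_neqAle maxp // andbT.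
  apply: contra qp => /eqP/digits_inj qp.
  have {}qp : q.2 = p.2.
    by apply/ffunP; apply: qp => i; apply: leq_ltn_trans (leq_gen_deg _ i) _; rewrite ?qd ?pd.
  apply/eqP; move: ul pl ql qp; clear; elim: l => //= x l IHl /andP[xl ul].
  rewrite !inE => /orP[/eqP ->|pl] /orP[/eqP ->|ql] // qp.
  - by move: xl; rewrite -qp map_f.
  - by move: xl; rewrite qp map_f.
  - exact: IHl.
have ul' : uniq l by exact: map_uniq ul.
have Lp : p.1 * mon (fun i => p.2 i + h i)%N \isin L.
  have : \sum_(q <- l) q.1 * mon (fun i => q.2 i + h i)%N \isin L.
    have -> : \sum_(q <- l) q.1 * mon (fun i => q.2 i + h i)%N =
              mon h * \sum_(q <- l) q.1 * mon q.2.
      by rewrite mulr_sumr; apply: eq_bigr => q _; rewrite gen_monD; ring.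
    case: lQ => [x [y [Qx My ->]]]; rewrite mulrDr; apply: idealD.
      by apply: idealM; exact: QL.
    by apply: ML; rewrite addnC -addnS; apply: ideal_powD => //; exact: gen_mon_pow.
  rewrite (bigD1_seq p) //= addrC; apply: idealDl.
  rewrite big_seq_cond; apply: ideal_sum => q /andP[]; exact: others.
have [u Mu] := maxM.2 _ nMp.
set x := mon _ in Lp *.
have -> : x = u * (p.1 * x) - (u * p.1 - 1) * x by ring.
apply: idealB; first exact: idealM.
apply: ML; apply: ideal_powM => //.
by rewrite -pd -gen_degD; exact: gen_mon_pow.
Qed.

End ChainToIndependent.

Section StandardCount.
Context {R : comPzRingType} {r n : nat} (b : 'I_r -> R) (M Q : ideal R).
Hypothesis bM : forall i, b i \isin M.
Hypothesis genM : forall L : ideal R, (forall i, b i \isin L) -> M `<=` L.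
Hypothesis maxM : maximal_ideal M.
Local Notation mon := (gen_mon b).

(** Monomials of degree at most [k] are adjoined by decreasing degree, then by increasing [digits].
    Multiplication by [M] raises the degree, so each adds at most 1 to the length. One with more
    than [n] exponents above [D] is a multiple of a leading monomial in [n + 1] of these variables,
    so it lies in the ideal already reached. *)
Lemma relations_colength :
  (forall sigma : {ffun 'I_n.+1 -> 'I_r}, injective sigma ->
     exists d, form_relation b M Q sigma d) ->
  exists C, forall k N, colength_ge (ideal_add Q (ideal_pow M k.+1)) N ->
    (N <= C * k.+1 ^ n)%N.
Proof.
move=> rel.
(* The degree is 0 by default when [sigma] is not injective. *)
have /choice[deg degP] (sigma : {ffun 'I_n.+1 -> 'I_r}) :
    exists d, injective sigma -> form_relation b M Q sigma d.
  have [/rel[d dP]|ns] := pselect (injective sigma); first by exists d.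
  by exists 0%N => /ns.
pose D := (\max_sigma deg sigma)%N.
have lead (sigma : {ffun 'I_n.+1 -> 'I_r}) (s_inj : injective sigma) :=
  leading_monomial bM maxM (degP sigma s_inj)
    (leq_bigmax sigma : (deg sigma < D.+1)%N).
exists (2 ^ r * D.+1 ^ r)%N => k N.
pose T := {ffun 'I_r -> 'I_k.+1}.
pose fn (g : T) : 'I_r -> nat := fun i => g i.
(* The factor exceeds every value of [digits] in degree at most [k], so that [key] compares
   lexicographically. *)
pose key (e : 'I_r -> nat) := ((k - gen_deg e) * (k * D.+1 ^ r).+1 + digits D.+1 e)%N.
pose s := sort (fun g h => key (fn g) <= key (fn h))%N
  [seq g <- enum {: T} | (gen_deg (fn g) <= k)%N].
pose std := [pred g : T | (#|[pred i | (D < g i)%N]| <= n)%N].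
move=> QN; apply: leq_trans (card_few_large r n D k).
have us : uniq s by rewrite sort_uniq filter_uniq // enum_uniq.
apply: (@leq_trans (count std s)); last first.
  rewrite -size_filter -(card_uniqP _) ?filter_uniq //.
  by apply: subset_leq_card; apply/fintype.subsetP => g; rewrite mem_filter => /andP[].
have mem_s (e : 'I_r -> nat) : (gen_deg e <= k)%N -> exists2 g, g \in s & fn g =1 e.
  move=> ek; have eE i : e i = ([ffun j => inord (e j)] : T) i.
    by rewrite ffunE inordK // ltnS; apply: leq_trans ek; exact: leq_gen_deg.
  exists [ffun j => inord (e j)] => [|i]; last by rewrite /fn -eE.
  by rewrite mem_sort mem_filter mem_enum andbT -(eq_gen_deg eE).
have s_deg g : g \in s -> (gen_deg (fn g) <= k)%N.
  by rewrite mem_sort mem_filter => /andP[].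
apply: (colength_le_list (x := fun g => mon (fn g)) maxM) QN.
  move=> s1 y s2 sE; set L := foldl _ _ _.
  have QML : ideal_add Q (ideal_pow M k.+1) `<=` L by exact: foldl_adjoin_sub.
  have yk : (gen_deg (fn y) <= k)%N by apply: s_deg; rewrite sE mem_cat mem_head orbT.
  have small (e : 'I_r -> nat) : (gen_deg e <= k)%N -> (key e < key (fn y))%N -> mon e \isin L.
    move=> ek ey; have [g gs ge] := mem_s e ek.
    rewrite -(eq_gen_mon b ge); apply: foldl_adjoin_mem.
    move: gs; rewrite sE mem_cat => /orP[gs1|]; first exact: (map_f (fun g => mon (fn g))).
    have keyg : key (fn g) = key e by rewrite /key (eq_gen_deg ge) (eq_digits _ ge).
    have tr : transitive (fun g h : T => key (fn g) <= key (fn h))%N.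
      by move=> ? ? ?; exact: leq_trans.
    have : sorted (fun g h : T => key (fn g) <= key (fn h))%N s.
      by apply: sort_sorted => ? ?; exact: leq_total.
    rewrite sE sorted_pairwise // pairwise_cat => /and3P[_ _ /= /andP[/allP h _]].
    rewrite inE => /orP[/eqP gy|/h]; last by rewrite keyg leqNgt ey.
    by move: ey; rewrite -keyg gy ltnn.
  have larger (e : 'I_r -> nat) : (gen_deg (fn y) < gen_deg e <= k)%N -> mon e \isin L.
    move=> /andP[ye ek]; apply: small => //; rewrite /key.
    have dk : (digits D.+1 e <= k * D.+1 ^ r)%N.
      by apply: leq_trans (digits_le e (ltn0Sn D)) _; rewrite leq_mul2r ek orbT.
    have -> : (k - gen_deg (fn y) = (k - gen_deg e) + (gen_deg e - gen_deg (fn y)))%N by lia.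
    have : (0 < gen_deg e - gen_deg (fn y))%N by lia.
    case: (_ - _)%N => // m _; rewrite mulnDl mulSn; lia.
  have powL : ideal_pow M (gen_deg (fn y)).+1 `<=` L.
    apply: (ideal_pow_gen genM) => e ey; have [ek|ke] := leqP (gen_deg e) k.
      by apply: larger; rewrite ey ltnSn -ey.
    have ek : gen_deg e = k.+1 by apply/eqP; rewrite eqn_leq ke ey ltnS yk.
    by apply: QML; apply: ideal_addr; rewrite -ek; exact: gen_mon_pow.
  split=> [z Mz|]; first by apply: powL; apply: ideal_powM => //; exact: gen_mon_pow.
  rewrite -ltnNge => large_y.
  (* [sigma] lists [n + 1] of the variables with exponent above [D]. *)
  pose A := [pred i | (D < y i)%N].
  pose sigma : {ffun 'I_n.+1 -> 'I_r} := [ffun t => enum_val (widen_ord large_y t : 'I_#|A|)].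
  have s_inj : injective sigma.
    by move=> t t'; rewrite !ffunE => /enum_val_inj/(congr1 val) /= tt'; exact: val_inj.
  have [e [ed e0 eL]] := lead sigma s_inj.
  (* The leading monomial involves only these variables, with exponents at most its degree, hence at
     most [D]; so it divides the monomial of [y]. *)
  have ey i : (e i <= y i)%N.
    have [/existsP[t /eqP <-]|/existsPn nt] := boolP [exists t, sigma t == i]; last by rewrite e0.
    have : sigma t \in A by rewrite ffunE; exact: enum_valP.
    move=> /ltnW; apply: leq_trans; apply: leq_trans (leq_gen_deg _ _) _.
    by rewrite ed; exact: leq_bigmax.
  pose h i := (y i - e i)%N.
  have yE : (fun i => e i + h i)%N =1 fn y by move=> i; rewrite /h subnKC.
  have ydeg : (deg sigma + gen_deg h)%N = gen_deg (fn y).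
    by rewrite -ed -gen_degD; exact: eq_gen_deg.
  rewrite -(eq_gen_mon b yE); apply: eL.
  - exact: subset_trans (@ideal_addl _ _ _) QML.
  - by rewrite ydeg.
  move=> e' e'd e'e; have hdeg : gen_deg (fun i => e' i + h i)%N = gen_deg (fn y).
    by rewrite gen_degD e'd ydeg.
  apply: small; first by rewrite hdeg.
  rewrite /key hdeg ltn_add2l digitsD -(eq_digits _ yE) digitsD ltn_add2r.
  exact: e'e.
have [|g gs g0] := mem_s (fun=> 0%N); first by rewrite /gen_deg big1.
have -> : 1 = mon (fn g).
  by rewrite (eq_gen_mon b g0) /gen_mon big1 // => i _; rewrite expr0.
by apply: foldl_adjoin_mem; exact: (map_f (fun g => mon (fn g))).
Qed.

End StandardCount.

(** * Homogeneous relations from dependent powers *)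

Section DependentRelation.
Context {R : comPzRingType} {r n : nat} (b : 'I_r -> R) (M Q : ideal R) (w : nat -> nat).
Hypothesis bM : forall i, b i \isin M.
Hypothesis M1 : ~ 1 \isin M.
Hypothesis primeQ : prime_ideal Q.
Hypothesis w_gt0 : forall i, (0 < w i)%N.
Variables (c : R) (sigma : {ffun 'I_n -> 'I_r}).
Hypothesis nQc : ~ c \isin Q.
Hypothesis sigma_inj : injective sigma.

(** Exponents of the [b j] after substituting [(b (sigma i) * c) ^+ w i] for the [i]-th variable;
    taking [w i]-th powers turns weight into degree. *)
Definition push_mon (e : 'X_{1..n}) : {ffun 'I_r -> nat} :=
  [ffun j => \sum_(i < n | sigma i == j) w i * e i]%N.

Lemma push_monE e i : push_mon e (sigma i) = (w i * e i)%N.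
Proof.
by rewrite ffunE (bigD1 i) //= big1 ?addn0 // => j /andP[/eqP/sigma_inj -> /eqP].
Qed.

Lemma push_mon_inj : injective push_mon.
Proof.
move=> e e' ee'; apply/eqP/cmP => i; have := push_monE e i.
by rewrite ee' push_monE => /eqP; rewrite eqn_pmul2l ?w_gt0 // => /eqP.
Qed.

Lemma push_mon_deg e : gen_deg (push_mon e) = wdeg w e.
Proof.
rewrite /gen_deg /wdeg [RHS](partition_big sigma predT) //=.
by apply: eq_bigr => j _; rewrite ffunE.
Qed.

Lemma push_mon_eval e : mon_eval (fun i => (b (sigma i) * c) ^+ w i) e =
  gen_mon b (push_mon e) * c ^+ wdeg w e.
Proof.
have -> : mon_eval (fun i => (b (sigma i) * c) ^+ w i) e =
    \prod_i (b (sigma i) ^+ (w i * e i) * c ^+ (w i * e i)).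
  by apply: eq_bigr => i _; rewrite -exprM exprMn.
rewrite big_split /=; congr (_ * _); last first.
  rewrite /wdeg; elim/big_rec2: _ => [|i x y _ ->]; first by rewrite expr0.
  by rewrite exprD.
rewrite (partition_big sigma predT) //=; apply: eq_bigr => j _; rewrite ffunE.
rewrite (eq_bigr (fun i : 'I_n => b j ^+ (w i * e i))) => [|i /eqP -> //].
elim/big_rec2: _ => [|i x y _ ->]; first by rewrite expr0.
by rewrite exprD.
Qed.

(** With [d] the least weight, the common factor [c^d] cancels modulo [Q]. The terms of greater
    weight lie in [M^(d + 1)]; those of weight [d] form the relation, and its invertible coefficient
    is outside [M]. *)
Lemma dependent_form_relation :
  ~ weighted_independent w (fun i => (b (sigma i) * c) ^+ w i) ->
  exists d, form_relation b M Q sigma d.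
Proof.
have R1 : (1 : R) != 0 by apply/eqP => R0; apply: M1; rewrite R0; exact: ideal0.
move=> /(dependent_relation R1)[f [m [f0 [u fmu] mf]]].
have nMfm : ~ f@_m \isin M by move=> Mf; apply: M1; rewrite -fmu; exact: idealMr.
have fm : m \in msupp f.
  by rewrite -mcoeff_neq0; apply/eqP => fm0; apply: nMfm; rewrite fm0; exact: ideal0.
pose d := wdeg w m; exists d.
pose F e := f@_e * gen_mon b (push_mon e).
have QF : \sum_(e <- msupp f) F e * c ^+ (wdeg w e - d) \isin Q.
  have : c ^+ d * (\sum_(e <- msupp f) F e * c ^+ (wdeg w e - d)) \isin Q.
    suff -> : c ^+ d * (\sum_(e <- msupp f) F e * c ^+ (wdeg w e - d)) = 0.
      exact: ideal0.
    rewrite -[RHS]f0 (pevalEw _ (fsubset_refl _)) mulr_sumr [LHS]big_seq [RHS]big_seq.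
    apply: eq_bigr => e ef; rewrite push_mon_eval.
    have -> : c ^+ wdeg w e = c ^+ d * c ^+ (wdeg w e - d) by rewrite -exprD subnKC ?mf.
    by rewrite /F -!mulrA mulrCA; congr (_ * _); rewrite mulrCA.
  by case: (primeQ) => _ _ pQ /pQ[/prime_expr-/(_ primeQ)|].
exists [seq (f@_e, push_mon e) | e <- msupp f & wdeg w e == d]; split.
- rewrite -map_comp map_inj_uniq ?filter_uniq ?fset_uniq //.
  exact: push_mon_inj.
- move=> p /mapP[e]; rewrite mem_filter => /andP[/eqP ed ef] -> /=.
  split=> [|i ni]; first by rewrite push_mon_deg.
  by rewrite ffunE big_pred0 // => t; exact/negbTE/ni.
- rewrite big_map big_filter (eq_bigr F) //.
  have -> : \sum_(e <- msupp f | wdeg w e == d) F e =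
     \sum_(e <- msupp f) F e * c ^+ (wdeg w e - d) -
     \sum_(e <- msupp f | wdeg w e != d) F e * c ^+ (wdeg w e - d).
    rewrite [X in _ = X - _](bigID (fun e => wdeg w e == d)) /= addrK; apply: eq_bigr => e /eqP ->.
    by rewrite subnn expr0 mulr1.
  apply: idealB; first exact: ideal_addl.
  rewrite big_seq_cond; apply: ideal_sum => e /andP[ef de].
  apply: ideal_addr; apply/idealMr/idealM.
  apply: ideal_pow_le (gen_mon_pow bM (push_mon e)).
  by rewrite push_mon_deg ltn_neqAle eq_sym de mf.
- exists (f@_m, push_mon m) => //; apply/mapP; exists m => //.
  by rewrite mem_filter eqxx.
Qed.

End DependentRelation.

(** Without variables, a polynomial is a constant and equals its value. *)
Lemma empty_independent (R : comPzRingType) (w : nat -> nat) (a : 'I_0 -> R) :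
  (1 : R) != 0 -> weighted_independent w a.
Proof.
move=> R1; apply: contrapT => /(dependent_relation R1)[f [m [f0 [u fu] _]]].
suff f1 : f@_m = 0 by move: fu; rewrite f1 mul0r => /esym/eqP; rewrite (negbTE R1).
rewrite -f0 (@pevalEw _ _ _ f [fset m]%fset); last first.
  by apply/fsubsetP => e _; rewrite in_fset1; apply/cmP => -[].
by rewrite big_seq_fset1 /mon_eval big_ord0 mulr1.
Qed.

Lemma chain_to_independent (R : comPzRingType) (J M Q : ideal R) (w : nat -> nat) n :
  noetherian R -> (forall i, (0 < w i)%N) -> maximal_ideal M ->
  prime_ideal Q -> ~ (J `<=` Q) -> prime_chain_in M n Q ->
  exists a : 'I_n -> R, (forall i, a i \isin J) /\ weighted_independent w a.
Proof.
move=> noethR w_gt0 maxM primeQ JQ chain; have [M1 _] := maxM.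
have [c [Jc nQc]] : exists c, c \isin J /\ ~ c \isin Q.
  apply: contrapT => nc; apply: JQ => c Jc; apply: contrapT => nQc.
  by apply: nc; exists c.
case: n chain => [|n] chain.
  exists (fun=> 0); split=> [[]//|]; apply: empty_independent.
  by apply/eqP => R0; apply: M1; rewrite R0; exact: ideal0.
apply: contrapT => nindep.
have [s [sM genM]] := noetherian_fg noethR M.
pose b (i : 'I_(size s)) := tnth (in_tuple s) i.
have bM i : b i \isin M by apply: sM; exact: mem_tnth.
have genb (L : ideal R) : (forall i, b i \isin L) -> M `<=` L.
  by move=> bL; apply: genM => x /(@tnthP _ _ (in_tuple s))[i ->].
have [sigma s_inj|C upC] := relations_colength (n := n) (Q := Q) bM genb maxM.
  apply: (dependent_form_relation bM M1 primeQ w_gt0 nQc s_inj) => indep.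
  apply: nindep; exists (fun i => (b (sigma i) * c) ^+ w i); split=> // i.
  (* Since [w i] is positive, a factor [c] from [J] can be taken out. *)
  by rewrite -(prednK (w_gt0 i)) exprS mulrAC; exact: idealM.
(* The lower bound has degree [n + 1] in [k], the upper bound only degree [n]. *)
have [c' low] := colength_lower_bound noethR M1 chain.
have [k] := bin_gt_poly C c' n.
by rewrite ltnNge => /negP; apply; apply: upC; exact: low.
Qed.

(** * Primes of R / (0 : J^oo) *)

Section FinalComparison.
Context {R : comPzRingType}.
Implicit Types (I J K M Q : ideal R).

(* [Q] is maximal among the ideals that contain no [u J^m] with [u] outside [P]. *)
Lemma prime_below (P : set R) J : noetherian R -> prime_ideal P ->
  colon_zero_infty J `<=` P ->
  exists Q : ideal R, [/\ prime_ideal Q, Q `<=` P & ~ (J `<=` Q)].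
Proof.
move=> noethR [iP P1 PM] KP.
pose avoid I := forall u m, ~ P u -> ~ (ideal_pow J m `<=` colon I u).
have iZ : is_ideal [set 0 : R].
  by split=> [|x y -> ->|a x ->] //=; rewrite ?addr0 ?mulr0.
(* The zero ideal qualifies: [u J^m = 0] would put [u] in [0 : J^oo], hence in [P]. *)
have [|Q [_ avQ maxQ]] := noetherian_max noethR (Q := avoid) (I := Ideal iZ).
  move=> u m nPu Ju; apply: nPu; apply: KP; exists m => // x /Ju /=.
  by rewrite mulrC.
(* Avoidance for [m = 0] gives [Q] inside [P]; for [u = 1] and [m = 1] it shows that [Q] does not
   contain [J]. *)
have QP : Q `<=` P.
  move=> x Qx; apply: contrapT => nPx; apply: (avQ x 0%N nPx) => y _.
  exact: idealM.
exists Q; split=> //; last first.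
  move=> JQ; apply: (avQ 1 1%N P1) => x /ideal_pow_sub/JQ Qx.
  by rewrite /= mulr1.
split=> [|/QP //|x y Qxy]; first exact: idealP.
apply: contrapT => /not_orP[nQx nQy].
have adjoin z : ~ z \isin Q ->
    exists u m, ~ P u /\ ideal_pow J m `<=` colon (ideal_adjoin Q z) u.
  move=> nQz; have := maxQ (ideal_adjoin Q z) (@ideal_adjoinl _ _ _).
  move=> /(_ (fun s => nQz (s _ (ideal_adjoinr _ _)))) navoid.
  apply: contrapT => nex; apply: navoid => u m nPu Ju; apply: nex.
  by exists u, m.
have [u [m [nPu Ju]]] := adjoin x nQx.
have [v [l [nPv Jv]]] := adjoin y nQy.
apply: (avQ (u * v) (m + l)%N); first by move=> /PM[].
apply: ideal_pow_split => s t /Ju[p Qp] /Jv[q Qq] /=.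
have -> : s * t * (u * v) = (s * u - p * x) * (t * v)
    + p * x * (t * v - q * y) + (p * q) * (x * y) by ring.
by apply: idealD; [apply: idealD; [exact: idealMr|exact: idealM]|exact: idealM].
Qed.

Lemma prime_chain_inP M n (P : nat -> set R) I :
  (forall i, (i <= n)%N -> prime_ideal (P i)) ->
  (forall i, (i < n)%N -> P i `<` P i.+1) ->
  I `<=` P 0%N -> P n `<=` M -> prime_chain_in M n I.
Proof.
elim: n P I => [|n IHn] P I pP ltP IP PM.
  by have [Q QE] := prime_is_ideal (pP _ (leqnn _)); exists Q; rewrite QE; split=> //; exact: pP.
have [Q QE] := prime_is_ideal (pP 0%N isT); exists Q; rewrite QE; split=> //; first exact: pP.
have [P01 /existsNP[x /not_implyP[P1x nP0x]]] := ltP 0%N isT.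
exists x => //; apply: (IHn (fun i => P i.+1)) => //.
- by move=> i ni; exact: pP.
- by move=> i ni; exact: ltP.
have [Q1 Q1E] := prime_is_ideal (pP 1%N isT); rewrite -Q1E; apply: ideal_adjoin_sub.
  by rewrite QE Q1E.
by rewrite Q1E.
Qed.

Lemma prime_chain_in_chain M n I : prime_chain_in M n I ->
  exists P : nat -> set R, [/\ forall i, (i <= n)%N -> prime_ideal (P i),
    forall i, (i < n)%N -> P i `<` P i.+1 & I `<=` P 0%N].
Proof.
elim: n I => [|n IHn] I [P [pP IP]].
  by move=> _; exists (fun=> ideal_set P); split.
move=> [x nPx /IHn[P' [pP' ltP' PxP']]].
exists (fun i => if i is j.+1 then P' j else ideal_set P); split=> //.
- by case=> [|i] // ni; exact: pP'.
- case=> [|i] ni; last exact: ltP'.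
  split=> [y Py|P'P]; first by apply: PxP'; exact: ideal_adjoinl.
  by apply: nPx; apply: P'P; apply: PxP'; exact: ideal_adjoinr.
Qed.

Section QuotientPrimes.
Local Open Scope quotient_scope.
Variable K : ideal R.
Local Notation piK := (\pi_(quotient_ring K)).

Lemma quotient_pi_repr x : repr (piK x) - x \isin K.
Proof. by apply/asboolP/quotient_eqP; rewrite reprK. Qed.

Lemma quotient_piMr x y : piK x * piK y = piK (x * y).
Proof. exact: quotient_piM. Qed.

Lemma quotient_pi0 : piK 0 = 0.
Proof. by apply: (addrI (piK 0)); rewrite quotient_piD !addr0. Qed.

Lemma prime_preimage (P : set (quotient_ring K)) :
  prime_ideal P -> prime_ideal [set x | P (piK x)].
Proof.
move=> [[P0 PD PM] P1 pP]; split=> [|//|x y]; last first.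
  by rewrite /= -quotient_piMr => /pP.
split=> [|x y Px Py|a x Px] /=.
- by rewrite quotient_pi0.
- by rewrite -quotient_piD; exact: PD.
- by rewrite -quotient_piMr; exact: PM.
Qed.
(** As [K] lies in [P], membership does not depend on the chosen representative. *)
Lemma prime_image (P : set R) : prime_ideal P -> K `<=` P ->
  prime_ideal [set y : quotient_ring K | P (repr y)].
Proof.
move=> pP KP; have [Q QE] := prime_is_ideal pP; rewrite -QE in pP KP *.
have piP x : repr (piK x) \isin Q <-> x \isin Q.
  have Kx := KP _ (quotient_pi_repr x); split=> Qx.
    by rewrite -[x](subKr (repr (piK x))); exact: idealB.
  by rewrite -(subrK x (repr _)); exact: idealD.
case: (pP) => _ Q1 QM; split=> [||x y] /=.
- split=> [|x y|a x] /=.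
  + by rewrite -quotient_pi0; apply/piP; exact: ideal0.
  + rewrite -[x]reprK -[y]reprK quotient_piD => /piP Qx /piP Qy.
    by apply/piP; exact: idealD.
  + rewrite -[x]reprK -[a]reprK quotient_piMr => /piP Qx.
    by apply/piP; exact: idealM.
- by move=> /piP.
- rewrite -[x]reprK -[y]reprK quotient_piMr => /piP/QM[Qx|Qy]; [left|right]; exact/piP.
Qed.

Lemma quotient_chainP n : prime_chain (quotient_ring K) n <->
  exists P : nat -> set R, [/\ forall i, (i <= n)%N -> prime_ideal (P i),
    forall i, (i < n)%N -> P i `<` P i.+1 & K `<=` P 0%N].
Proof.
split=> [[P [pP ltP]]|[P [pP ltP KP]]].
  exists (fun i => [set x | P i (piK x)]); split.
  - by move=> i ni; apply: prime_preimage; exact: pP.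
  - move=> i ni; have [sub nsub] := ltP i ni; split=> [x|sub']; first exact: sub.
    by apply: nsub => y; rewrite -[y]reprK; exact: sub'.
  - move=> x Kx /=; have -> : piK x = 0.
      by rewrite -quotient_pi0; apply/quotient_eqP/asboolP; rewrite subr0.
    by have [[]] := pP 0%N isT.
have KPi i : (i <= n)%N -> K `<=` P i.
  elim: i => // i IHi ni; have [sub _] := ltP i ni.
  by apply: subset_trans sub; exact/IHi/ltnW.
exists (fun i => [set y : quotient_ring K | P i (repr y)]); split.
  by move=> i ni; apply: prime_image; [exact: pP|exact: KPi].
move=> i ni; have [sub nsub] := ltP i ni; split=> [y|sub']; first exact: sub.
apply: nsub => x Px.
have [Q QE] := prime_is_ideal (pP i (ltnW ni)).
have [Q' Q'E] := prime_is_ideal (pP i.+1 ni).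
have Kx := quotient_pi_repr x.
have /sub' : P i.+1 (repr (piK x)).
  rewrite -Q'E -(subrK x (repr _)); apply: idealD; last by rewrite Q'E.
  by rewrite Q'E; exact: KPi Kx.
rewrite /= -QE => Qx; rewrite -[x](subKr (repr (piK x))); apply: idealB => //.
by rewrite QE; apply: KPi Kx; exact: ltnW.
Qed.

End QuotientPrimes.

(** The ideal [initial_coefs] is proper: a form with coefficient 1 at its least weight and value
    killed by [J^t] would become, multiplied by the [t]-th power of the first variable, a relation
    violating independence. *)
Lemma independent_chain J (w : nat -> nat) n (a : 'I_n.+1 -> R) :
  noetherian R -> (forall i, a i \isin J) -> weighted_independent w a ->
  prime_chain (quotient_ring (colon_zero_infty_ideal J)) n.+1.
Proof.
move=> noethR Ja indep; set K := colon_zero_infty_ideal J.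
have [|M initM maxM] := maximal_ideal_exists noethR (I := initial_coefs w a K).
  move=> [l [m [lm [t _ lt] l1]]].
  pose e := \big[mmul/mone]_(i < t) ucm ord0 : 'X_{1..n.+1}.
  have et : mon_eval a e = a ord0 ^+ t.
    rewrite /e; elim: (t) => [|k IHk]; first by rewrite big_ord0 mon_eval1.
    rewrite big_ord_recl mon_evalM exprS -IHk; congr (_ * _).
    rewrite /mon_eval (bigD1 ord0) //= cmU eqxx expr1 big1 ?mulr1 // => i /negbTE i0.
    by rewrite cmU eq_sym i0 expr0.
  apply: (@form_dependent _ _ w a (form_scale 1 e l) (mmul e m)) indep.
  - by rewrite form_eval_scale mul1r et mulrC; apply: lt; exact: ideal_pow_exp.
  - by rewrite form_coef_scale l1 mul1r.
  - by move=> p /mapP[q /lm mq ->]; rewrite !wdegM leq_add2l.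
have := initial_coefs_chain noethR maxM initM.
by move=> /prime_chain_in_chain; rewrite quotient_chainP.
Qed.

(** [prime_below] supplies a prime [Q0] inside the first prime of the chain that does not contain
    [J]; lengths are then counted modulo [Q0]. *)
Lemma chain_independent J (w : nat -> nat) n : noetherian R -> (forall i, (0 < w i)%N) ->
  prime_chain (quotient_ring (colon_zero_infty_ideal J)) n ->
  exists a : 'I_n -> R, (forall i, a i \isin J) /\ weighted_independent w a.
Proof.
move=> noethR w_gt0 /quotient_chainP[P [pP ltP KP]].
have [Q0 [pQ0 Q0P JQ0]] := prime_below noethR (pP 0%N isT) KP.
have [Pn PnE] := prime_is_ideal (pP n (leqnn n)).
have [|M PM maxM] := maximal_ideal_exists noethR (I := Pn).
  by rewrite PnE; case: (pP n (leqnn n)).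
rewrite PnE in PM; apply: (chain_to_independent noethR w_gt0 maxM pQ0 JQ0).
exact: prime_chain_inP pP ltP Q0P PM.
Qed.

End FinalComparison.

Theorem theorem1p9 (R : comPzRingType) (J : ideal R) (w : nat -> nat) :
  noetherian R ->
  (forall i : nat, (0 < w i)%N) ->
  krull_dim (quotient_ring (colon_zero_infty_ideal J)) =
  nat_sup [set s : nat | exists a : 'I_s -> R,
             (forall i : 'I_s, ideal_set J (a i)) /\ weighted_independent w a].
Proof.
move=> noethR w_gt0; rewrite /krull_dim.
set D := [set n | _]; set I := [set s | _].
have DI : D `<=` I by move=> n; exact: chain_independent.
have ID n : I n.+1 -> D n.+1 by move=> [a [Ja indep]]; exact: independent_chain indep.
have [D0|nD0] := pselect (D 0%N).
  by congr nat_sup; rewrite eqEsubset; split=> // -[|n] // /ID.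
(* If [D 0] fails, the quotient has no prime ideal: [D] is empty and [I] contains at most 0, so both
   suprema are 0. *)
have DE : D = set0.
  rewrite -subset0 => n [P [pP _]]; apply: nD0; exists P; split=> // i.
  by rewrite leqn0 => /eqP ->; exact: pP.
have : I `<=` [set 0%N] by move=> [|n] // /ID; rewrite DE.
rewrite DE => /subset_set1[->|->] //.
have ub0 : has_ubound (set0 : set nat).
  by apply: subset_has_ubound (has_ub_set1 0%N); exact: sub0set.
by rewrite /nat_sup !asboolT ?supremum0 ?supremum1 //; exact: has_ub_set1.
Qed.
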